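(* Let $H$ be a Krull monoid and $\varphi\colon H\to\mathcal F(P)$ a cofinal divisor homomorphism into a free monoid such that the class group $G=\mathcal C(\varphi)$ is an infinite cyclic group, which we identify with $\mathbb Z$. Let $G_P\subset G$ denote the set of classes containing prime divisors, and suppose that $G_P^-$ is finite. Let $a\in H$ with $\max\mathsf L(a)=|\boldsymbol\beta(a)^+|+\mathsf v_0(\boldsymbol\beta(a))$ and let $M=|\min(\mathrm{supp}(\boldsymbol\beta(a)))|$. Then, for any factorization $z\in\mathsf Z(a)$ and any factorization $y\in\mathsf Z(a)$ with $|y|=\max\mathsf L(a)$, there exists a chain of factorizations $z=z_0,\dots,z_r=y$ of $a$ such that $|z|=|z_0|\le\dots\le|z_r|=|y|$ and $$\mathsf d(z_i,z_{i+1})\le\max\{M\cdot\mathsf D(\mathcal S(G_P^-),\mathcal E(G_P^-)),2\}\le\max\{|\min G_P|\cdot\mathsf D(\mathcal S(G_P^-),\mathcal E(G_P^-)),2\}<\infty$$ for all $i\in[0,r-1]$.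
   Context: $\mathbb N$ is the set of positive integers, $\mathbb N_0=\mathbb N\cup\{0\}$, and $[a,b]=\{x\in\mathbb Z: a\le x\le b\}$. A monoid is a commutative cancellative semigroup with unit element. For a monoid $H$: $H^\times$ is its group of units, $H_{\mathrm{red}}=\{aH^\times: a\in H\}$, $\mathsf q(H)$ its quotient group, $\mathcal A(H)$ its set of atoms. $\mathcal F(P)$ is the free abelian monoid with basis $P$, and $|a|=\sum_p\mathsf v_p(a)$ is the length of $a=\prod_pp^{\mathsf v_p(a)}\in\mathcal F(P)$. A monoid homomorphism $\varphi\colon H\to D$ is a divisor homomorphism if $\varphi(a)\mid\varphi(b)$ implies $a\mid b$; it is cofinal if for every $a\in D$ there is $u\in H$ with $a\mid\varphi(u)$. $H$ is a Krull monoid if there is a divisor homomorphism from $H$ into a free abelian monoid. The class group is $\mathcal C(\varphi)=\mathsf q(D)/\mathsf q(\varphi(H))$, written additively, with $[a]=a\,\mathsf q(\varphi(H))$. For $D=\mathcal F(P)$, $G_P=\{[p]: p\in P\}$. When $\mathcal C(\varphi)=\mathbb Z$, $G_P^+=G_P\cap\mathbb N$ and $G_P^-=G_P\cap(-\mathbb N)$. $\mathsf Z(H)=\mathcal F(\mathcal A(H_{\mathrm{red}}))$, $\pi\colon\mathsf Z(H)\to H_{\mathrm{red}}$ is the homomorphism with $\pi(u)=u$ for atoms $u$; for $a\in H$, $\mathsf Z(a)=\pi^{-1}(aH^\times)$ and $\mathsf L(a)=\{|z|: z\in\mathsf Z(a)\}$. For $z,z'\in\mathsf Z(H)$, $\mathsf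 d(z,z')=\max\{|z\gcd(z,z')^{-1}|,|z'\gcd(z,z')^{-1}|\}$. Elements $S=\prod_g g^{\mathsf v_g(S)}\in\mathcal F(G_0)$, $G_0\subset\mathbb Z$, are called sequences over $G_0$; $\mathrm{supp}(S)=\{g:\mathsf v_g(S)>0\}$, $\sigma(S)=\sum_g\mathsf v_g(S)g$, $S^+=\prod_{g>0}g^{\mathsf v_g(S)}$; $\mathcal B(G_0)=\{S\in\mathcal F(G_0):\sigma(S)=0\}$. The block homomorphism $\boldsymbol\beta\colon H\to\mathcal B(G_P)$ is given by $\boldsymbol\beta(a)=[p_1]\cdots[p_l]$ when $\varphi(a)=p_1\cdots p_l$ with $p_i\in P$. If $a$ is a unit (so $\boldsymbol\beta(a)$ is the empty sequence), put $M=0$. For a nonempty set $G_0\subset\mathbb Z\setminus\{0\}$, $\mathcal E(G_0)=\{(S_1,S_2)\in\mathcal F(G_0)\times\mathcal F(G_0):\sigma(S_1)=\sigma(S_2)\}$ and $\mathcal S(G_0)=\{(S,S): S\in\mathcal F(G_0)\}\subset\mathcal E(G_0)$. For (reduced) monoids $H'\subset D$, the relative Davenport constant $\mathsf D(H',D)$ is the minimum $N\in\mathbb N\cup\{\infty\}$ such that whenever $1\ne z\in\mathsf Z(D)=\mathcal F(\mathcal A(D))$ with $\pi(z)\in H'$, there exists $1\neq z'\mid z$ with $\pi(z')\in H'$ and $|z'|\le N$. *)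

(* Defs.v *)
From HB Require Import structures.
From mathcomp Require Import all_boot all_order all_algebra.
From mathcomp Require Import generic_quotient ring_quotient.
From mathcomp Require Import finmap multiset.
From mathcomp Require Import boolp classical_sets functions cardinality.
From mathcomp Require Import constructive_ereal.

Set Implicit Arguments.
Unset Strict Implicit.
Unset Printing Implicit Defensive.

Import Order.TTheory GRing.Theory Num.Theory.
Local Open Scope mset_scope.
Local Open Scope classical_set_scope.
Local Open Scope quotient_scope.
Local Open Scope ring_scope.

(* Monoids are commutative and cancellative, and are written additively: the
   product of a and b is a + b, the unit element is 0, and a divides b when
   b = a + c for some c. *)
HB.mixin Record Nmodule_isCancellative V of GRing.Nmodule V := {
  addmI : forall x : V, injective (+%R x)
}.

#[short(type="cmonoidType")]
HB.structure Definition CMonoid :=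
  { V of GRing.Nmodule V & Nmodule_isCancellative V }.

Lemma addIm (V : cmonoidType) (x : V) : injective (+%R^~ x).
Proof. by move=> y z /=; rewrite ![_ + x]addrC => /addmI. Qed.

(* The free abelian monoid with basis P is {mset P}: the exponent v_p(a) is
   a p, the length |a| is size a (which counts multiplicities), and gcd is the
   multiset intersection. *)
Section FreeMonoid.
Variable P : choiceType.

HB.instance Definition _ := Choice.copy (multiset P) {fsfun P -> nat with 0%N}.
HB.instance Definition _ := GRing.isNmodule.Build (multiset P)
  (@msetDA P) (@msetDC P) (@mset0D P).

Fact mset_addmI (a : multiset P) : injective (+%R a).
Proof.
move=> b c e; apply/msetP => p.
by move/(congr1 (fun m : {mset P} => m p)): e; rewrite !msetE2 => /addnI.
Qed.

HB.instance Definition _ := Nmodule_isCancellative.Build (multiset P)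
  mset_addmI.

End FreeMonoid.

Section Monoid.
Variable H : cmonoidType.
Implicit Types a b c u : H.

Definition mdvd a b : Prop := exists c, b = a + c.

Definition munit a : Prop := exists b, a + b = 0.

Definition matom u : Prop :=
  ~ munit u /\ forall b c, u = b + c -> munit b \/ munit c.

(* H_red is the quotient of H by its group of units. *)
Definition massoc a b : bool := `[< exists2 u, munit u & b = a + u >].

Fact massoc_is_equiv : equiv_class_of massoc.
Proof.
split=> [a|a b|b a c].
- by apply/asboolP; exists 0; rewrite ?addr0 //; exists 0; rewrite addr0.
- have sym x y : massoc x y -> massoc y x.
    move=> /asboolP[u [v uv] ->]; apply/asboolP; exists v.
      by exists u; rewrite addrC.
    by rewrite -addrA uv addr0.
  by apply/idP/idP; apply: sym.
- move=> /asboolP[u [u' uu'] ->] /asboolP[v [v' vv'] ->]; apply/asboolP.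
  exists (u + v); last by rewrite addrA.
  by exists (u' + v'); rewrite addrACA uu' vv' addr0.
Qed.
Canonical massoc_equiv := EquivRelPack massoc_is_equiv.
Canonical massoc_encModRel := defaultEncModRel massoc.

Definition reduced := {eq_quot massoc}.
HB.instance Definition _ := EqQuotient.on reduced.
HB.instance Definition _ := Choice.on reduced.

Definition red0 : reduced := lift_cst reduced 0.
Definition red_add := lift_op2 reduced +%R.

Canonical pi_red0_morph := PiConst red0.

Fact pi_red_add : {morph \pi_reduced : a b / a + b >-> red_add a b}.
Proof.
move=> a b; unlock red_add; apply/eqmodP/asboolP.
have /eqmodP/asboolP[u [u' uu'] ->] : a = repr (\pi_reduced a) %[mod reduced].
  by rewrite reprK.
have /eqmodP/asboolP[v [v' vv'] ->] : b = repr (\pi_reduced b) %[mod reduced].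
  by rewrite reprK.
exists (u + v); last by rewrite addrACA.
by exists (u' + v'); rewrite addrACA uu' vv' addr0.
Qed.
Canonical pi_red_add_morph := PiMorph2 pi_red_add.

Fact red_addA : associative red_add.
Proof. by move=> x y z; rewrite -[x]reprK -[y]reprK -[z]reprK !piE addrA. Qed.
Fact red_addC : commutative red_add.
Proof. by move=> x y; rewrite -[x]reprK -[y]reprK !piE addrC. Qed.
Fact red_add0 : left_id red0 red_add.
Proof. by move=> x; rewrite -[x]reprK !piE add0r. Qed.
HB.instance Definition _ :=
  GRing.isNmodule.Build reduced red_addA red_addC red_add0.

Fact pi_red_addE a b :
  \pi_reduced (a + b) = \pi_reduced a + \pi_reduced b :> reduced.
Proof. exact: pi_red_add. Qed.

Fact red_addmI (x : reduced) : injective (+%R x).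
Proof.
move=> y z; rewrite -[x]reprK -[y]reprK -[z]reprK.
rewrite -!pi_red_addE => /eqmodP/asboolP[u uu].
by rewrite -addrA => /addmI e; apply/eqmodP/asboolP; exists u.
Qed.
HB.instance Definition _ := Nmodule_isCancellative.Build reduced red_addmI.

(* The quotient group q(H): the pair (a, b) stands for a - b. *)
Definition qequiv (x y : H * H) : bool := x.1 + y.2 == y.1 + x.2.

Fact qequiv_is_equiv : equiv_class_of qequiv.
Proof.
split=> [x|x y|y x z]; rewrite /qequiv.
- exact: eqxx.
- exact: eq_sym.
- move=> /eqP xy /eqP yz; apply/eqP; apply: (@addIm _ y.2) => /=.
  by rewrite addrAC xy -addrA [x.2 + _]addrC addrA yz addrAC.
Qed.
Canonical qequiv_equiv := EquivRelPack qequiv_is_equiv.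
Canonical qequiv_encModRel := defaultEncModRel qequiv.

Definition qgroup := {eq_quot qequiv}.
HB.instance Definition _ := EqQuotient.on qgroup.
HB.instance Definition _ := Choice.on qgroup.

Definition qg0 : qgroup := lift_cst qgroup 0.
Definition qg_add := lift_op2 qgroup +%R.
Definition qg_opp := lift_op1 qgroup (fun x : H * H => (x.2, x.1)).

Canonical pi_qg0_morph := PiConst qg0.

Fact pi_qg_add : {morph \pi_qgroup : x y / x + y >-> qg_add x y}.
Proof.
move=> x y; unlock qg_add; apply/eqmodP; rewrite /= /qequiv /=.
have /eqmodP/eqP ex : x = repr (\pi_qgroup x) %[mod qgroup] by rewrite reprK.
have /eqmodP/eqP ey : y = repr (\pi_qgroup y) %[mod qgroup] by rewrite reprK.
by apply/eqP; rewrite addrACA ex ey addrACA.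
Qed.
Canonical pi_qg_add_morph := PiMorph2 pi_qg_add.

Fact pi_qg_opp :
  {morph \pi_qgroup : x / (x.2, x.1) : H * H >-> qg_opp x}.
Proof.
move=> x; unlock qg_opp; apply/eqmodP; rewrite /= /qequiv /=.
have /eqmodP/eqP ex : x = repr (\pi_qgroup x) %[mod qgroup] by rewrite reprK.
by apply/eqP; rewrite addrC -ex addrC.
Qed.
Canonical pi_qg_opp_morph := PiMorph1 pi_qg_opp.

Fact qg_addA : associative qg_add.
Proof. by move=> x y z; rewrite -[x]reprK -[y]reprK -[z]reprK !piE addrA. Qed.
Fact qg_addC : commutative qg_add.
Proof. by move=> x y; rewrite -[x]reprK -[y]reprK !piE addrC. Qed.
Fact qg_add0 : left_id qg0 qg_add.
Proof. by move=> x; rewrite -[x]reprK !piE add0r. Qed.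
Fact qg_addN : left_inverse qg0 qg_opp qg_add.
Proof.
move=> x; rewrite -[x]reprK !piE; apply/eqmodP; rewrite /= /qequiv /=.
by rewrite addr0 add0r addrC.
Qed.
HB.instance Definition _ :=
  GRing.isZmodule.Build qgroup qg_addA qg_addC qg_add0 qg_addN.

Fact pi_qg_addE (x y : H * H) :
  \pi_qgroup (x + y) = \pi_qgroup x + \pi_qgroup y :> qgroup.
Proof. exact: pi_qg_add. Qed.

Definition qincl a : qgroup := \pi_qgroup (a, 0).

Definition atomT := {u : H | `[< matom u >]}.
HB.instance Definition _ := Choice.on atomT.

(* The homomorphism F(A(H)) -> H that is the identity on atoms. *)
Definition fprod (z : {mset atomT}) : H := \sum_(u <- z) val u.

End Monoid.

(* The factorization monoid Z(H) = F(A(H_red)). *)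
Notation Zmon H := {mset atomT (reduced H)}.

Section Factorizations.
Variable H : cmonoidType.

Definition factorizations (a : H) : set (Zmon H) :=
  [set z | fprod z = \pi_(reduced H) a].

Definition lengths (a : H) : set nat :=
  [set size z | z in factorizations a].

Definition fdist (z z' : Zmon H) : nat :=
  maxn (size (z `\` (z `&` z'))%mset) (size (z' `\` (z `&` z'))%mset).

End Factorizations.

Definition is_max (A : set nat) (m : nat) : Prop := A m /\ ubound A m.

(* The minimum of a set of integers, and 0 when there is none; in particular
   intset_min set0 = 0. *)
Definition intset_min (A : set int) : int := xget 0 [set m | A m /\ lbound A m].

Section DivisorHom.
Variables (H D : cmonoidType) (phi : {additive H -> D}).

Definition divisor_hom : Prop :=
  forall a b, mdvd (phi a) (phi b) -> mdvd a b.

Definition cofinal_hom : Prop := forall a : D, exists u : H, mdvd a (phi u).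

(* The subgroup q(phi(H)) of q(D). *)
Definition qimage : {pred qgroup D} :=
  fun x => `[< exists a b : H, x = qincl (phi a) - qincl (phi b) >].

Fact qincl_additive (x y : D) : qincl (x + y) = qincl x + qincl y.
Proof.
rewrite /qincl -pi_qg_addE; congr (\pi_(qgroup D) _).
by have -> : (x, 0) + (y, 0) = (x + y, 0 + 0) :> D * D by []; rewrite addr0.
Qed.

Fact qincl0 : qincl 0 = 0 :> qgroup D.
Proof.
by apply: (@addrI _ (qincl 0)); rewrite -qincl_additive !addr0.
Qed.

Fact qimage_zmod_closed : zmod_closed qimage.
Proof.
split=> [|x y /asboolP[a [b ->]] /asboolP[c [d ->]]]; apply/asboolP.
  by exists 0, 0; rewrite subrr.
exists (a + d), (b + c).
rewrite [phi (a + d)]raddfD [phi (b + c)]raddfD !qincl_additive.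
by rewrite opprB opprD addrACA.
Qed.
HB.instance Definition _ := GRing.isZmodClosed.Build _ qimage qimage_zmod_closed.

Definition class_group : zmodType := Quotient.quot qimage.

Definition class_of (a : D) : class_group :=
  \pi_(Quotient.quot qimage) (qincl a).

Fact class_ofD (x y : D) : class_of (x + y) = class_of x + class_of y.
Proof. by rewrite /class_of qincl_additive raddfD. Qed.

Fact class_of_phi (a : H) : class_of (phi a) = 0.
Proof.
rewrite /class_of -[0](raddf0 (\pi_(Quotient.quot qimage))).
apply/eqmodP; rewrite /= /Quotient.equiv subr0; apply/asboolP.
by exists a, 0; rewrite raddf0 qincl0 subr0.
Qed.

End DivisorHom.

Definition krull (H : cmonoidType) : Prop :=
  exists (P : choiceType) (phi : {additive H -> {mset P}}), divisor_hom phi.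

(* Sequences over a set G0 of integers are the S : {mset int} with
   seq_supp S `<=` G0. *)
Section Sequences.
Implicit Types S : {mset int}.

Definition seq_supp S : set int := [set g | g \in S].

Definition seq_sum S : int := \sum_(g <- S) g.

Definition block (G0 : set int) : set {mset int} :=
  [set S | seq_supp S `<=` G0 /\ seq_sum S = 0].

Definition pos_part S : {mset int} := seq_mset [seq g <- S | 0 < g].

Definition negative (G0 : set int) : set int := G0 `&` [set g | g < 0].

Definition eqsum (G0 : set int) : {pred {mset int} * {mset int}} := fun x =>
  [&& `[< seq_supp x.1 `<=` G0 >], `[< seq_supp x.2 `<=` G0 >]
    & seq_sum x.1 == seq_sum x.2].

Fact perm_msetD S S' : perm_eq (S + S' : {mset int}) (S ++ S').
Proof.
by apply/allP => g _; rewrite /= count_cat !count_mem_mset msetE2.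
Qed.

Fact seq_sumD S S' : seq_sum (S + S') = seq_sum S + seq_sum S'.
Proof. by rewrite /seq_sum (perm_big _ (perm_msetD S S')) big_cat. Qed.

Fact seq_suppD S S' : seq_supp (S + S') = seq_supp S `|` seq_supp S'.
Proof.
have -> : S + S' = (S `+` S')%mset by [].
by apply/seteqP; split=> g; rewrite /seq_supp /= in_msetD => /orP.
Qed.

Fact eqsum_addr_closed (G0 : set int) : addr_closed (eqsum G0).
Proof.
split=> [|x y /and3P[/asboolP x1 /asboolP x2 /eqP ex]
             /and3P[/asboolP y1 /asboolP y2 /eqP ey]].
  have s0 : seq_supp 0 `<=` G0.
    by move=> g; rewrite /seq_supp (_ : 0 = mset0) //= in_mset0.
  by apply/and3P; split=> //; apply/asboolP.
apply/and3P; split=> /=.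
- by apply/asboolP; rewrite seq_suppD subUset.
- by apply/asboolP; rewrite seq_suppD subUset.
- by apply/eqP; rewrite !seq_sumD ex ey.
Qed.
HB.instance Definition _ (G0 : set int) :=
  GRing.isAddClosed.Build _ (eqsum G0) (eqsum_addr_closed G0).

(* The monoid E(G0) of pairs of sequences over G0 with equal sums. *)
Definition eqsum_monoid (G0 : set int) :=
  {x : {mset int} * {mset int} | eqsum G0 x}.
HB.instance Definition _ (G0 : set int) := SubChoice.on (eqsum_monoid G0).
HB.instance Definition _ (G0 : set int) :=
  GRing.SubChoice_isSubNmodule.Build _ _ (eqsum_monoid G0)
    (eqsum_addr_closed G0).

Fact eqsum_addmI (G0 : set int) (x : eqsum_monoid G0) : injective (+%R x).
Proof.
move=> y z /(congr1 val) e; apply/val_inj => /=.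
have {}e : val x + val y = val x + val z by [].
move: (congr1 fst e) (congr1 snd e) => /= /addmI e1 /addmI e2.
by case: (val y) (val z) e1 e2 => [y1 y2] [z1 z2] /= -> ->.
Qed.
HB.instance Definition _ (G0 : set int) :=
  Nmodule_isCancellative.Build (eqsum_monoid G0) (@eqsum_addmI G0).

(* The subset S(G0) of E(G0). *)
Definition diag_pairs (G0 : set int) : set (eqsum_monoid G0) :=
  [set x | (val x).1 = (val x).2].

End Sequences.

Arguments diag_pairs : clear implicits.

(* Here iota identifies the class group with the integers. *)
Section BlockHom.
Variables (H : cmonoidType) (P : choiceType).
Variables (phi : {additive H -> {mset P}}).
Variables (iota : {additive class_group phi -> int}).

Definition prime_class (p : P) : int := iota (class_of phi [mset p]).

Definition GP : set int := range prime_class.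

Definition beta (a : H) : {mset int} :=
  seq_mset [seq prime_class p | p <- (phi a : {mset P})].

Fact sum_mset1 (s : seq P) : \sum_(p <- s) [mset p] = seq_mset s.
Proof.
apply/msetP => q; rewrite mset_seqE.
elim: s => [|p s IHs]; first by rewrite big_nil mset0E.
by rewrite big_cons msetE2 IHs msetnE /= eq_sym; case: eqP.
Qed.

Fact beta_block (a : H) : block GP (beta a).
Proof.
split=> [g|].
  rewrite /seq_supp /= (perm_mem (perm_eq_seq_mset _)) => /mapP[p _ ->].
  by exists p.
rewrite /seq_sum (perm_big _ (perm_eq_seq_mset _)) big_map.
have iotaE (s : seq P) : \sum_(p <- s) prime_class p
    = iota (class_of phi (\sum_(p <- s) [mset p])).
  elim: s => [|p s IHs]; last by rewrite !big_cons IHs class_ofD raddfD.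
  by rewrite !big_nil -(raddf0 phi) class_of_phi raddf0.
by rewrite iotaE sum_mset1 seq_mset_id class_of_phi raddf0.
Qed.

End BlockHom.

Local Open Scope ereal_scope.

(* The relative Davenport constant D(H', D) of a subset H' of a reduced
   monoid D. *)
Section Davenport.
Variables (D : cmonoidType) (H' : set D).

Definition davenport_bound (N : nat) : Prop :=
  (0 < N)%N /\
  forall z : {mset atomT D}, z != 0%R -> H' (fprod z) ->
  exists z' : {mset atomT D},
    [/\ z' != 0%R, (z' `<=` z)%mset, H' (fprod z') & (size z' <= N)%N].

Definition rel_davenport : \bar int :=
  xget +oo [set N%:Z%:E | N in
    [set N | davenport_bound N /\ lbound davenport_bound N]].

End Davenport.

(* Main.v *)
(** Up to units, H is the monoid of multisets of primes whose classes sum to 0,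
    so factorizations are multisets of minimal such multisets.  Every atom
    contains a prime of nonnegative class, and the hypothesis on the maximal
    length says that each atom v of y contains exactly one.  Hence the atoms of y
    can be grouped so that the group attached to an atom u of z has the same
    nonnegative primes as u; let u' be the sum of that group.  The negative
    classes by which u and u' differ form a pair in E(G_P^-); splitting these
    pairs, for all u, into atoms of E(G_P^-) gives a factorization whose value
    lies in S(G_P^-), and by definition of the relative Davenport constant D some
    nonempty part of it, with at most D atoms, also has its value in S(G_P^-).
    Exchanging the corresponding primes between at most D atoms of z brings z
    closer to y.  By Lambert's bound an atom of E has components of length at most
    M, and each new atom meets what was moved in, so at most M * D new atoms
    appear.  Once u and u' agree up to classes, each group is a single atom, and
    swapping pairs of equivalent primes, at distance at most 2, leads to y.
    Finiteness of D follows from Dickson's lemma, applied to the atoms of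
    E(G_P^-) and then to the factorizations into them. *)
Require Import Defs.
From mathcomp Require Import all_boot all_order all_algebra.
From mathcomp Require Import generic_quotient ring_quotient.
From mathcomp Require Import finmap multiset.
From mathcomp Require Import boolp classical_sets functions cardinality.
From mathcomp Require Import constructive_ereal.
From mathcomp Require Import zify.

Set Implicit Arguments.
Unset Strict Implicit.
Unset Printing Implicit Defensive.

Import Order.TTheory GRing.Theory Num.Theory.
Local Open Scope mset_scope.
Local Open Scope classical_set_scope.
Local Open Scope quotient_scope.
Local Open Scope ring_scope.

(* The counts of a multiset have a type convertible but not syntactically equal
   to nat, which lia does not recognise. *)
Ltac mlia :=
  repeat match goal with
  | |- context [@fun_of_fsfun ?a ?b ?c ?f ?x] =>
      let n := fresh "n" in set n : nat := @fun_of_fsfun a b c f x; move: n => n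
  end; lia.

(** * Multisets *)

Section Multisets.
Variable K : choiceType.
Implicit Types (A B C : {mset K}) (s : seq K).

Lemma madd0E (a : K) : (0 : {mset K}) a = 0%N.
Proof. exact: mset0E. Qed.

Lemma maddE A B (a : K) : (A + B : {mset K}) a = (A a + B a)%N.
Proof. by rewrite msetE2. Qed.

Lemma msumE I (r : seq I) (Q : pred I) (F : I -> {mset K}) (a : K) :
  (\sum_(i <- r | Q i) F i) a = (\sum_(i <- r | Q i) F i a)%N.
Proof.
by rewrite (big_morph (fun A : {mset K} => A a) (fun A B => maddE A B a) (madd0E a)).
Qed.

Lemma perm_madd A B : perm_eq (A + B : {mset K}) (A ++ B).
Proof.
by apply/allP => a _; rewrite /= count_cat !count_mem_mset maddE.
Qed.

Lemma big_madd (V : nmodType) (F : K -> V) A B :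
  \sum_(a <- (A + B : {mset K})) F a = \sum_(a <- A) F a + \sum_(a <- B) F a.
Proof. by rewrite (perm_big _ (perm_madd A B)) big_cat. Qed.

Lemma big_m0 (V : nmodType) (F : K -> V) : \sum_(a <- (0 : {mset K})) F a = 0.
Proof. exact: big_mset0. Qed.

Lemma big_m1 (V : nmodType) (F : K -> V) (b : K) : \sum_(a <- [mset b]) F a = F b.
Proof. exact: big_msetn. Qed.

Lemma big_seq_mset (V : nmodType) (F : K -> V) s :
  \sum_(a <- seq_mset s) F a = \sum_(a <- s) F a.
Proof. by rewrite (perm_big _ (perm_eq_seq_mset s)). Qed.

Lemma big_msum (V : nmodType) (F : K -> V) I (r : seq I) (Q : pred I)
    (G : I -> {mset K}) :
  \sum_(a <- (\sum_(i <- r | Q i) G i : {mset K})) F a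
    = \sum_(i <- r | Q i) \sum_(a <- G i) F a.
Proof.
rewrite (big_morph (fun A : {mset K} => \sum_(a <- A) F a)
  (big_madd F) (big_m0 F)) //.
Qed.

Lemma size_madd A B : size (A + B : {mset K}) = (size A + size B)%N.
Proof. by rewrite (perm_size (perm_madd A B)) size_cat. Qed.

Lemma size_m0 : size (0 : {mset K}) = 0%N.
Proof. exact: size_mset0. Qed.

Lemma size_msum I (r : seq I) (Q : pred I) (G : I -> {mset K}) :
  size (\sum_(i <- r | Q i) G i : {mset K}) = (\sum_(i <- r | Q i) size (G i))%N.
Proof.
by rewrite (big_morph (fun A : {mset K} => size A) size_madd size_m0).
Qed.

Lemma size_meq0 A : size A = 0%N -> A = 0.
Proof. by move=> /eqP; rewrite size_mset_eq0 => /eqP. Qed.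

Lemma size_seq_mset s : size (seq_mset s) = size s.
Proof. exact: perm_size (perm_eq_seq_mset s). Qed.

Lemma seq_mset_cat (s t : seq K) : seq_mset (s ++ t) = seq_mset s + seq_mset t.
Proof. by apply/msetP => a; rewrite maddE !mset_seqE count_cat. Qed.

Lemma msub_add A B : (A `<=` A + B)%mset.
Proof. by apply/msubsetP => a; rewrite maddE leq_addr. Qed.

Lemma msubK A B : (A `<=` B)%mset -> A + (B `\` A)%mset = B.
Proof. exact: msetBDKC. Qed.

Lemma madd_eq0 A B : A + B = 0 -> A = 0 /\ B = 0.
Proof.
move=> /msetP e; split; apply/msetP => a; move: (e a);
  rewrite maddE !madd0E; mlia.
Qed.

Lemma mem_madd A B a : (a \in (A + B : {mset K})) = (a \in A) || (a \in B).
Proof. exact: in_msetD. Qed.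

Lemma msum_eq0 I (r : seq I) (Q : pred I) (G : I -> {mset K}) :
  \sum_(i <- r | Q i) G i = 0 ->
  \sum_(i <- r | Q i) size (G i) = 0%N.
Proof. by move=> e; rewrite -size_msum e size_m0. Qed.

(** Riesz decomposition, done greedily: the last summand contributes its intersection with [A], and
    what is left of [A] fits into the others. *)
Lemma msub_sumP k (F : nat -> {mset K}) A :
  (A `<=` \sum_(j < k) F j)%mset ->
  exists G : nat -> {mset K},
    (forall j, (j < k)%N -> (G j `<=` F j)%mset) /\ \sum_(j < k) G j = A.
Proof.
elim: k A => [|k IHk] A.
  rewrite big_ord0 => /msubsetP A0; exists (fun=> 0); split=> //.
  rewrite big_ord0; apply/msetP => a.
  by have := A0 a; rewrite madd0E leqn0 => /eqP.
rewrite big_ord_recr /= => /msubsetP le.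
have le' : (A `\` F k `<=` \sum_(j < k) F j)%mset.
  apply/msubsetP => a; have := le a; rewrite maddE !msetE2; mlia.
have [G [leG sumG]] := IHk _ le'.
exists (fun j => if (j < k)%N then G j else (A `&` F k)%mset); split.
  move=> j; rewrite ltnS leq_eqVlt => /orP[/eqP->|jk].
    by rewrite ltnn; exact: msubsetIr.
  by rewrite jk; exact: leG.
rewrite big_ord_recr /= ltnn (eq_bigr (fun j : 'I_k => G j)).
  rewrite sumG; apply/msetP => a; rewrite maddE !msetE2; mlia.
by move=> j _; rewrite ltn_ord.
Qed.

End Multisets.

Section MultisetMap.
Variables (K L : choiceType) (f : K -> L).
Implicit Types A B : {mset K}.

Definition mmap A : {mset L} := seq_mset (map f A).

Lemma mmapD : {morph mmap : A B / A + B}.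
Proof.
move=> A B; apply/msetP => g; rewrite maddE !mset_seqE.
by rewrite -count_cat -map_cat (permP (perm_map f (perm_madd A B))).
Qed.

Lemma mmap0 : mmap 0 = 0.
Proof. by apply: (@addmI _ (mmap 0)); rewrite -mmapD !addr0. Qed.

Lemma mmap_sum I (r : seq I) (Q : pred I) (G : I -> {mset K}) :
  mmap (\sum_(i <- r | Q i) G i) = \sum_(i <- r | Q i) mmap (G i).
Proof. by rewrite (big_morph mmap mmapD mmap0). Qed.

Lemma mmap1 p : mmap [mset p] = [mset f p].
Proof.
by apply/msetP => g; rewrite mset_seqE enum_msetn /= msetnE eq_sym; case: eqP.
Qed.

Lemma size_mmap A : size (mmap A) = size A.
Proof. by rewrite size_seq_mset size_map. Qed.

Lemma mmap_eq0 A : mmap A = 0 -> A = 0.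
Proof. by move=> e; apply: size_meq0; rewrite -size_mmap e size_m0. Qed.

Lemma big_mmap (V : nmodType) (F : L -> V) A :
  \sum_(g <- mmap A) F g = \sum_(p <- A) F (f p).
Proof. by rewrite big_seq_mset big_map. Qed.

Lemma mem_mmap A g : g \in mmap A -> exists2 p, p \in A & g = f p.
Proof. by rewrite (perm_mem (perm_eq_seq_mset _)) => /mapP. Qed.

Lemma mmap_f A p : p \in A -> f p \in mmap A.
Proof. by move=> pA; rewrite (perm_mem (perm_eq_seq_mset _)) map_f. Qed.

(** Elements are chosen greedily along an enumeration of [A]: one is put into [X] whenever its image
    is still wanted. This is how a prescribed sequence of classes is realised by actual primes. *)
Lemma mmap_lift A (B : {mset L}) :
  (B `<=` mmap A)%mset -> exists2 X, (X `<=` A)%mset & mmap X = B.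
Proof.
rewrite -{2}[A]seq_mset_id /mmap; elim: (enum_mset A) B => [|p s IHs] B /=.
  move=> /msubsetP B0; exists 0; first exact: msub0set.
  rewrite -/(mmap 0) mmap0; apply/msetP => g.
  by have := B0 g; rewrite mset_seqE madd0E leqn0 => /eqP.
move=> /msubsetP le.
have le' : (B `\` [mset f p] `<=` seq_mset [seq f i | i <- s])%mset.
  apply/msubsetP => g; have := le g.
  by rewrite msetE2 !mset_seqE msetnE /= eq_sym; move: (count_mem g _);
  case: eqP => _ m; mlia.
have [X lX eX] := IHs _ le'; rewrite mset_cons.
case: (boolP (f p \in B)) => pB.
  exists ([mset p] + X); first exact: msetDS.
  rewrite -/(mmap _) mmapD mmap1 /mmap eX; apply: msubK.
  by rewrite msub1set.
exists X.
  by apply: msubset_trans lX _; apply/msubsetP => q; rewrite msetE2 leq_addl.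
rewrite eX; apply/msetP => g; rewrite msetE2 msetnE; case: eqP => [->|_].
  by rewrite (mset_eq0P pB).
by rewrite subn0.
Qed.

(** Lifting one part at a time partitions [A] along a partition of its image; this serves to deal
    removed primes out to new groups. *)
Lemma mmap_split k (G : nat -> {mset L}) A :
  mmap A = \sum_(j < k) G j ->
  exists X : nat -> {mset K},
    (forall j, (j < k)%N -> mmap (X j) = G j) /\ \sum_(j < k) X j = A.
Proof.
elim: k A => [|k IHk] A.
  by rewrite big_ord0 => /mmap_eq0 ->; exists (fun=> 0); rewrite big_ord0.
rewrite big_ord_recr /= => e.
have [|X0 lX0 eX0] := @mmap_lift A (G k); first by rewrite e addrC msub_add.
have [|X [eX sX]] := IHk (A `\` X0)%mset.
  apply: (@addmI _ (G k)); rewrite -{1}eX0 -mmapD msubK // e addrC //.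
exists (fun j => if (j < k)%N then X j else X0); split.
  move=> j; rewrite ltnS leq_eqVlt => /orP[/eqP->|jk]; first by rewrite ltnn.
  by rewrite jk eX.
rewrite big_ord_recr /= ltnn (eq_bigr (fun j : 'I_k => X j)).
  by rewrite sX addrC msubK.
by move=> j _; rewrite ltn_ord.
Qed.

End MultisetMap.

(** * Atoms *)

Section RelativeAtoms.
Variables (V : nmodType) (Z : V -> Prop).

(* V is meant to be reduced, so that 0 is the only unit. *)
Definition relatom (u : V) : Prop :=
  [/\ Z u, u <> 0 & forall b c, Z b -> Z c -> u = b + c -> b = 0 \/ c = 0].

(** Since [sz] is additive and vanishes only at 0, both parts of a proper splitting are smaller, so
    induction on [sz] applies. *)
Lemma relatom_factor (sz : V -> nat) :
  {morph sz : x y / x + y >-> (x + y)%N} -> (forall x, sz x = 0%N -> x = 0) ->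
  forall x, Z x -> exists s : seq V,
    {in s, forall u, relatom u} /\ \sum_(u <- s) u = x.
Proof.
move=> szD sz0 x; have [n] := ubnP (sz x).
elim: n x => // n IHn x xn Zx.
have [->|/eqP x0] := eqVneq x 0; first by exists [::]; rewrite big_nil.
have [ax|nax] := pselect (relatom x).
  by exists [:: x]; rewrite big_seq1; split=> // u; rewrite inE => /eqP->.
have [b [c [Zb Zc xbc b0 c0]]] :
    exists b c, [/\ Z b, Z c, x = b + c, b <> 0 & c <> 0].
  apply: contrapT => H; apply: nax; split=> // b c Zb Zc xbc.
  apply: contrapT => /not_orP[b0 c0]; apply: H.
  by exists b, c.
have bpos : sz b <> 0%N by move/sz0.
have cpos : sz c <> 0%N by move/sz0.
have sx : sz x = (sz b + sz c)%N by rewrite xbc szD.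
have [|s [As es]] := IHn b _ Zb; first lia.
have [|t [At et]] := IHn c _ Zc; first lia.
exists (s ++ t); rewrite big_cat /= es et xbc; split=> // u.
by rewrite mem_cat => /orP[/As|/At].
Qed.

End RelativeAtoms.

Section AtomTransfer.
Variables (M : cmonoidType) (V : nmodType) (Z : V -> Prop) (f : M -> V).

(** Identifies [M] with the part of [V] cut out by [Z]. It serves twice: for E(G0) inside pairs of
    sequences, and for the reduced monoid of H inside the multisets of primes. *)
Definition embeds_onto : Prop :=
  [/\ f 0 = 0, {morph f : a b / a + b}, injective f, forall a, Z (f a)
    & forall x, Z x -> exists a, f a = x].

Hypothesis femb : embeds_onto.
Hypothesis conical : forall x y : V, x + y = 0 -> x = 0 /\ y = 0.

Lemma embeds_munit a : munit a <-> f a = 0.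
Proof.
have [f0 fD finj _ _] := femb; split=> [[b ab]|].
  by have [] : f a = 0 /\ f b = 0 by apply: conical; rewrite -fD ab f0.
by rewrite -f0 => /finj ->; exists 0; rewrite addr0.
Qed.

Lemma embeds_matom a : matom a <-> relatom Z (f a).
Proof.
have [f0 fD finj fZ fsurj] := femb; split=> [[nu ua]|[_ nz ua]].
  split=> [||x y Zx Zy]; first exact: fZ; first by move/embeds_munit.
  have [[b <-] [c <-]] := (fsurj _ Zx, fsurj _ Zy).
  rewrite -fD => /finj /ua[] /embeds_munit ->; by [left|right].
split=> [/embeds_munit //|b c abc].
have [|||/embeds_munit|/embeds_munit] := ua (f b) (f c) => //.
- by rewrite abc fD.
- by left.
- by right.
Qed.

Definition atom_values (z : {mset atomT M}) : {mset V} := mmap (f \o val) z.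

Lemma atom_valuesP (w : {mset V}) :
  (forall u, u \in w -> relatom Z u) -> exists z, atom_values z = w.
Proof.
have [f0 fD finj fZ fsurj] := femb.
rewrite -[w]seq_mset_id; elim: (enum_mset w) => [|u s IHs] As.
  by exists 0; rewrite /atom_values mmap0; apply/msetP => x; rewrite mset_seqE madd0E.
have mem t x : (x \in seq_mset t :> bool) = (x \in t :> bool).
  exact: (perm_mem (perm_eq_seq_mset t)).
have [|z ez] := IHs.
  by move=> x; rewrite mem => xs; apply: As; rewrite mem inE xs orbT.
have ru : relatom Z u by apply: As; rewrite mem mem_head.
have [a fa] : exists a, f a = u by apply: fsurj; case: ru.
have aa : `[< matom a >] by apply/asboolP/embeds_matom; rewrite fa.
exists ([mset (exist _ a aa : atomT M)] + z).
rewrite /atom_values mmapD mmap1 -/(atom_values z) ez /= fa.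
by rewrite mset_cons.
Qed.

Lemma atom_values_relatom z u : u \in atom_values z -> relatom Z u.
Proof. by move=> /mem_mmap[a _ ->] /=; apply/embeds_matom/asboolP/(valP a). Qed.

Lemma embeds_fprod (z : {mset atomT M}) : f (Defs.fprod z) = \sum_(u <- atom_values z) u.
Proof.
have [f0 fD _ _ _] := femb; rewrite big_mmap /Defs.fprod.
by elim: (enum_mset z) => [|u s IHs]; rewrite ?big_nil // !big_cons fD IHs.
Qed.

End AtomTransfer.

Section MultisetMapInj.
Variables (K L : choiceType) (f : K -> L).
Hypothesis finj : injective f.

Lemma mmapE (A : {mset K}) p : mmap f A (f p) = A p.
Proof.
by rewrite mset_seqE count_map (eq_count (fun q => inj_eq finj q p)) count_mem_mset.
Qed.

Lemma mmap_inj : injective (mmap f).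
Proof. by move=> A B e; apply/msetP => p; rewrite -2!mmapE e. Qed.

Lemma mmap_sub (A B : {mset K}) : (mmap f A `<=` mmap f B)%mset = (A `<=` B)%mset.
Proof.
apply/msubsetP/msubsetP => [le p|le g]; first by rewrite -2!mmapE.
have [/mem_mmap[p _ ->]|] := boolP (g \in mmap f A); first by rewrite !mmapE.
by rewrite -mset_eq0 => /eqP ->.
Qed.

End MultisetMapInj.

(** * Finiteness of the relative Davenport constant *)

(** From any index on, [g] attains a minimum; moving each time to such a minimum beyond the previous
    index gives the subsequence. *)
Lemma nondecreasing_subseq (g : nat -> nat) :
  exists h : nat -> nat, {homo h : i j / (i < j)%N} /\
    {homo g \o h : i j / (i <= j)%N}.
Proof.
have next n : exists m, (n <= m)%N /\ forall m', (n <= m')%N -> (g m <= g m')%N.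
  have ex : exists v, `[< exists2 m, (n <= m)%N & g m = v >].
    by exists (g n); apply/asboolP; exists n.
  case: (ex_minnP ex) => v /asboolP[m nm gm] vmin; exists m; split=> // m' nm'.
  by rewrite gm; apply: vmin; apply/asboolP; exists m'.
have [a aP] := choice next.
pose h := fix h n := if n is n'.+1 then a (h n').+1 else a 0%N.
have hS n : (h n < h n.+1)%N by have [] := aP (h n).+1.
have hm : {homo h : i j / (i < j)%N} by apply: homo_ltn => //; exact: ltn_trans.
exists h; split=> //; apply: homo_leq => [//| |i /=]; first exact: leq_trans.
case: i => [|i]; first by have [_] := aP 0%N; apply.
by have [_] := aP (h i).+1; apply; have := hS i; have := hS i.+1; rewrite /=; lia.
Qed.

(** One coordinate at a time: a further subsequence keeps the earlier coordinates nondecreasing. *)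
Lemma dickson (K : eqType) (d : seq K) (f : nat -> K -> nat) :
  exists h : nat -> nat, {homo h : i j / (i < j)%N} /\
    forall k, k \in d -> {homo (fun i => f (h i) k) : i j / (i <= j)%N}.
Proof.
elim: d => [|k d [h [hlt hle]]]; first by exists id; split.
have [g [glt gle]] := nondecreasing_subseq (fun i => f (h i) k).
exists (h \o g); split=> [i j /glt /hlt //|k'].
rewrite inE => /orP[/eqP->|k'd]; first exact: gle.
move=> i j ij; apply: hle => //.
by move: ij; rewrite leq_eqVlt => /orP[/eqP->//|/glt/ltnW].
Qed.

Section EqualSums.
Variable G0 : set int.
Implicit Types (x y : {mset int} * {mset int}).

Definition eqsumP x : Prop := eqsum G0 x.

Lemma eqsumPE x : eqsumP x <->
  [/\ forall g, g \in x.1 -> G0 g, forall g, g \in x.2 -> G0 g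
    & seq_sum x.1 = seq_sum x.2].
Proof.
split=> [/and3P[/asboolP h1 /asboolP h2 /eqP]|[h1 h2 e]]; first by split.
by apply/and3P; split; [apply/asboolP|apply/asboolP|apply/eqP].
Qed.

Lemma pair_add_eq0 x y : x + y = 0 -> x = 0 /\ y = 0.
Proof.
case: x y => [x1 x2] [y1 y2] e.
have /= /madd_eq0[-> ->] := congr1 fst e.
by have /= /madd_eq0[-> ->] := congr1 snd e.
Qed.

Let pval : eqsum_monoid G0 -> {mset int} * {mset int} := val.

Lemma eqsum_embeds : embeds_onto eqsumP pval.
Proof.
split=> //; [exact: valP|move=> x Zx].
by exists (Sub x Zx); rewrite /pval SubK.
Qed.

Lemma pair_size0 x : (size x.1 + size x.2)%N = 0%N -> x = 0.
Proof.
by case: x => x1 x2 /= /eqP; rewrite addn_eq0 => /andP[/eqP/size_meq0-> /eqP/size_meq0->].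
Qed.

Lemma pair_sizeD :
  {morph (fun x => size x.1 + size x.2)%N : x y / x + y >-> (x + y)%N}.
Proof. by move=> x y; rewrite !size_madd addnACA. Qed.

Lemma fst_sum (s : seq ({mset int} * {mset int})) :
  (\sum_(u <- s) u).1 = \sum_(u <- s) u.1.
Proof. exact: (big_morph fst). Qed.

Lemma snd_sum (s : seq ({mset int} * {mset int})) :
  (\sum_(u <- s) u).2 = \sum_(u <- s) u.2.
Proof. exact: (big_morph snd). Qed.

Lemma eqsum_factor x : eqsumP x -> exists s : seq ({mset int} * {mset int}),
  {in s, forall u, relatom eqsumP u} /\ \sum_(u <- s) u = x.
Proof. exact: (relatom_factor pair_sizeD pair_size0). Qed.

(** Among infinitely many atoms, Dickson's lemma finds two distinct ones with the first contained in
    the second. Their difference again has equal sums, against irreducibility of the second. *)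
Lemma finite_eqsum_atoms :
  finite_set G0 -> finite_set [set: atomT (eqsum_monoid G0)].
Proof.
move=> /finite_seqP[d G0d]; apply: contrapT => /infiniteP /card_leP[F].
pose f i := val (val (val (F (to_setT i)))).
pose c i (k : int + int) : nat :=
  match k with inl g => (f i).1 g | inr g => (f i).2 g end.
have [h [hlt hle]] := dickson ([seq inl g | g <- d] ++ [seq inr g | g <- d]) c.
have fP i : relatom eqsumP (f i).
  apply/(embeds_matom eqsum_embeds pair_add_eq0)/asboolP.
  exact: (valP (val (F (to_setT i)))).
have supp i :
    (forall g, g \in (f i).1 -> g \in d) /\ (forall g, g \in (f i).2 -> g \in d).
  have [/eqsumPE[h1 h2 _] _ _] := fP i.
  by split=> g; [move/h1|move/h2]; rewrite G0d.
pose i := h 0%N; pose j := h 1%N.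
have le1 : ((f i).1 `<=` (f j).1)%mset.
  apply/msubsetP => g; have [gd|gd] := boolP (g \in d).
    apply: (hle (inl g) _ 0%N 1%N) => //.
    by rewrite mem_cat map_f.
  by rewrite (mset_eq0P _) //; apply: contra gd; have [+ _] := supp i; apply.
have le2 : ((f i).2 `<=` (f j).2)%mset.
  apply/msubsetP => g; have [gd|gd] := boolP (g \in d).
    apply: (hle (inr g) _ 0%N 1%N) => //.
    by rewrite mem_cat map_f // orbT.
  by rewrite (mset_eq0P _) //; apply: contra gd; have [_ +] := supp i; apply.
pose r := ((f j).1 `\` (f i).1, (f j).2 `\` (f i).2)%mset.
have er : f j = f i + r by apply: injective_projections; rewrite /= msubK.
have [[Zi i0 _] [Zj _ ja]] := (fP i, fP j).
have Zr : eqsumP r.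
  move: Zi Zj; rewrite er => /eqsumPE[a1 a2 a3] /eqsumPE[b1 b2 b3].
  apply/eqsumPE; split=> [g gr|g gr|].
  - by apply: b1; rewrite mem_madd gr orbT.
  - by apply: b2; rewrite mem_madd gr orbT.
  - by move: b3; rewrite !seq_sumD a3 => /addrI.
case: (ja _ _ Zi Zr er) => // r0; move: er; rewrite r0 addr0.
move=> /val_inj /val_inj /val_inj /(@inj _ _ _ F) => /(_ (mem_set I) (mem_set I)).
move=> /(congr1 val) /= e; have := hlt 0%N 1%N isT; rewrite -/i -/j.
by rewrite (_ : j = i) ?ltnn.
Qed.

(** Without a bound there is, for every n, a factorization all of whose nonempty parts with value in
    S(G0) have more than n atoms. Only finitely many atoms exist, so Dickson's lemma makes one of
    these a part of a much later one. *)
Lemma davenport_bound_exists : finite_set G0 ->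
  exists N, davenport_bound (diag_pairs G0) N.
Proof.
move=> /finite_eqsum_atoms /finite_seqP[d ed].
apply: contrapT => noN.
have bad n : exists z : {mset atomT (eqsum_monoid G0)},
    [/\ z != 0, diag_pairs G0 (Defs.fprod z) & forall z' : {mset _}, z' != 0 ->
      (z' `<=` z)%mset -> diag_pairs G0 (Defs.fprod z') -> (n < size z')%N].
  apply: contrapT => nz; apply: noN; exists n.+1; split=> // z z0 dz.
  apply: contrapT => nz'; apply: nz; exists z; split=> // z' z'0 z'z dz'.
  rewrite ltnNge; apply/negP => le; apply: nz'; exists z'; split=> //.
  exact: leqW.
have [f fP] := choice bad.
have [h [hlt hle]] := dickson d (fun i k => f i k).
have hge i : (i <= h i)%N.
  by elim: i => // i IHi; apply: leq_ltn_trans IHi _; apply: hlt.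
(* With this index, the first factorization is a part of the one at [h m], so it should have more
   than [h m] atoms, yet it has only [m], which is at most [h m]. *)
pose m := size (f (h 0%N)).
have le : (f (h 0%N) `<=` f (h m))%mset.
  apply/msubsetP => k; apply: (hle k) => //.
  have : [set: atomT (eqsum_monoid G0)] k by [].
  by rewrite ed.
have [[_ _ H] [n0 D0 _]] := (fP (h m), fP (h 0%N)).
by have := leq_ltn_trans (hge m) (H _ n0 le D0); rewrite ltnn.
Qed.

Lemma rel_davenportP : finite_set G0 ->
  exists2 N : nat, davenport_bound (diag_pairs G0) N
    & rel_davenport (diag_pairs G0) = N%:Z%:E%E.
Proof.
move=> fG0; set B := davenport_bound _.
have ex : exists N, `[< B N >].
  by have [N BN] := davenport_bound_exists fG0; exists N; apply/asboolP.
case: (ex_minnP ex) => N /asboolP BN Nmin.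
have : [set N%:Z%:E%E | N in [set N | B N /\ lbound B N]] (rel_davenport (diag_pairs G0)).
  apply: xgetPex; exists N%:Z%:E%E; exists N => //; split=> // m Bm.
  by apply: Nmin; apply/asboolP.
by move=> [N' [BN' _] <-]; exists N'.
Qed.

(** The Davenport property for plain multisets of pairs, so that the exchange argument can avoid the
    subtype [eqsum_monoid]. *)
Lemma davenport_sub N : davenport_bound (diag_pairs G0) N ->
  forall z : {mset {mset int} * {mset int}}, z <> 0 ->
  (forall u, u \in z -> relatom eqsumP u) ->
  \sum_(u <- z) u.1 = \sum_(u <- z) u.2 ->
  exists z' : {mset {mset int} * {mset int}},
    [/\ z' <> 0, (z' `<=` z)%mset, \sum_(u <- z') u.1 = \sum_(u <- z') u.2
      & (size z' <= N)%N].
Proof.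
move=> [_ dav] z z0 Az ez.
have [a ea] := atom_valuesP eqsum_embeds pair_add_eq0 Az.
have sumE (b : {mset atomT (eqsum_monoid G0)}) : diag_pairs G0 (Defs.fprod b) <->
    \sum_(u <- atom_values pval b) u.1 = \sum_(u <- atom_values pval b) u.2.
  have e : pval (Defs.fprod b) = _ := embeds_fprod eqsum_embeds b.
  by rewrite /diag_pairs /= -/(pval _) e fst_sum snd_sum.
have [||a' [a'0 a'a da' sa']] := dav a.
- by apply/eqP => a0; apply: z0; rewrite -ea a0 /atom_values mmap0.
- by apply/sumE; rewrite ea.
exists (atom_values pval a'); split.
- by move=> /mmap_eq0 /eqP; rewrite (negbTE a'0).
- by rewrite -ea mmap_sub //; apply: inj_comp val_inj val_inj.
- exact/sumE.
- by rewrite size_mmap.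
Qed.

End EqualSums.

(** * Lambert's bound *)

Section Lambert.

Let pre (s : seq int) i : int := \sum_(g <- take i s) g.

Lemma sum_take_le (s : seq int) i j : {in s, forall g, g < 0} -> (i <= j)%N ->
  \sum_(g <- take j s) g <= \sum_(g <- take i s) g.
Proof.
move=> neg ij; rewrite -[take j s](cat_take_drop i) take_takel // big_cat /=.
rewrite gerDl big_seq sumr_le0 // => g /mem_drop /mem_take /neg; exact: ltW.
Qed.

Lemma sum_seg (s : seq int) i j : (i <= j)%N ->
  \sum_(g <- drop i (take j s)) g
    = \sum_(g <- take j s) g - \sum_(g <- take i s) g.
Proof.
move=> ij; apply/eqP; rewrite eq_sym subr_eq.
by rewrite -{1}[take j s](cat_take_drop i) take_takel // big_cat addrC.
Qed.

Lemma perm_seg (s : seq int) i j : (i <= j)%N ->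
  perm_eq (drop i (take j s) ++ (take i s ++ drop j s)) s.
Proof.
move=> ij; have e : s = take i s ++ drop i (take j s) ++ drop j s.
  by rewrite catA -{1}(take_takel s ij) !cat_take_drop.
by rewrite [X in perm_eq _ X]e perm_catCA.
Qed.

Lemma sum_lt0 (s : seq int) : s != [::] -> {in s, forall g, g < 0} ->
  \sum_(g <- s) g < 0.
Proof.
case: s => // g s _ neg; rewrite big_cons; apply: ltr_wnDr; last first.
  by apply: neg; rewrite mem_head.
by rewrite big_seq sumr_le0 // => g' g's; apply/ltW/neg; rewrite inE g's orbT.
Qed.

(* For each proper prefix of the second sequence take the first prefix of the
   first one with a strictly smaller sum; the gap lies in [1, M].  Two equal
   gaps would cut out a proper subpair with equal sums. *)
Lemma eqsum_atom_size (G0 : set int) (x : {mset int} * {mset int}) (M : nat) :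
  relatom (eqsumP G0) x ->
  (forall g, g \in x.1 -> g < 0 /\ - M%:Z <= g) ->
  (forall g, g \in x.2 -> g < 0) ->
  (size x.2 <= M)%N.
Proof.
case: x => [A B] [Zx x0 irr] /= negA negB.
have nA : {in (A : seq int), forall g, g < 0} by move=> g /negA[].
have eAB : seq_sum A = seq_sum B by case/eqsumPE: Zx.
pose a : seq int := A; pose b : seq int := B.
have gap (j : 'I_(size b)) : exists i : nat,
    0 < pre b j - pre a i /\ pre b j - pre a i <= M%:Z.
  have jb := ltn_ord j.
  have ex : exists i, pre a i < pre b j.
    (* All of [a] has the same sum as all of [b], which is strictly below the sum of a proper prefix
       of [b]. *)
    exists (size a); rewrite /pre take_size.
    rewrite (_ : \sum_(g <- a) g = \sum_(g <- b) g) //.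
    rewrite -{1}(cat_take_drop j b) big_cat /= gtrDl sum_lt0 //.
      by rewrite -size_eq0 size_drop subn_eq0 -ltnNge.
    by move=> g /mem_drop /negB.
  case: (ex_minnP ex) => i ai imin; exists i; rewrite subr_gt0; split=> //.
  (* The first such prefix is not empty: its sum would be 0, while prefix sums of [b] are at most 0.
     By minimality the preceding prefix sum is at least [pre b j], and one more term lowers it by at
     most M. *)
  case: i ai imin => [|i] ai imin.
    move: ai; rewrite /pre take0 big_nil ltNge => /negP[].
    by have := sum_take_le negB (leq0n j); rewrite take0 big_nil.
  have lb : pre b j <= pre a i.
    by rewrite leNgt; apply/negP => /imin; rewrite ltnn.
  have ia : (i < size a)%N.
    rewrite ltnNge; apply/negP => ai'; have ai2 := leqW ai'.
    move: (lt_le_trans ai lb).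
    by rewrite /pre (take_oversize ai2) (take_oversize ai') ltxx.
  have pS : pre a i.+1 = pre a i + nth 0 a i.
    by rewrite /pre (take_nth 0) // big_rcons.
  have [_] := negA _ (mem_nth 0 ia); rewrite pS -/a.
  by move: lb; move: (pre b j) (pre a i) (nth _ _ _) => u v w; lia.
have [t tP] := choice gap.
rewrite leqNgt; apply/negP => MB.
(* Gaps lie in [1, M], so their predecessors index ['I_M], and more than M prefixes force two equal
   gaps. *)
have dM (j : 'I_(size b)) : ((absz (pre b j - pre a (t j))).-1 < M)%N.
  by have := tP j; move: (pre b j - _) => u; lia.
pose d (j : 'I_(size b)) : 'I_M := Ordinal (dM j).
have [dinj|] := boolP (injectiveb d).
  have := leq_card d (injectiveP _ dinj); rewrite !card_ord.
  by rewrite leqNgt MB.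
move=> /injectivePn[j1 [j2 j12 /(congr1 val) /= ed]].
wlog lt12 : j1 j2 j12 ed / (j1 < j2)%N.
  move=> H; move: (j12); rewrite -val_eqE neq_ltn => /orP[/H|/H]; apply=> //.
  by rewrite eq_sym.
have gaps : pre b j1 - pre a (t j1) = pre b j2 - pre a (t j2).
  have [[p1 q1] [p2 q2]] := (tP j1, tP j2).
  move: ed p1 q1 p2 q2.
  move: (pre b j1 - _) (pre b j2 - _) => u v; lia.
have blt : pre b j2 < pre b j1.
  rewrite -subr_lt0 -sum_seg ?(ltnW lt12) //; apply: sum_lt0.
    by rewrite -size_eq0 size_drop size_takel ?subn_eq0 -?ltnNge // ltnW.
  by move=> g /mem_drop /mem_take /negB.
have t12 : (t j1 <= t j2)%N.
  rewrite leqNgt; apply/negP => /ltnW /(sum_take_le nA).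
  by rewrite -/(pre _ _) -/(pre _ _); move: gaps blt; rewrite -/a; lia.
pose y := (seq_mset (drop (t j1) (take (t j2) a)), seq_mset (drop j1 (take j2 b))).
pose z := (seq_mset (take (t j1) a ++ drop (t j2) a), seq_mset (take j1 b ++ drop j2 b)).
have xyz : (A, B) = y + z.
  apply: injective_projections; rewrite /= -seq_mset_cat -[LHS]seq_mset_id;
    by apply/esym/eq_seq_msetP/perm_seg => //; exact: ltnW.
have mem (s : seq int) g : (g \in seq_mset s :> bool) = (g \in s :> bool).
  exact: (perm_mem (perm_eq_seq_mset s)).
have [ZA ZB _] := (eqsumPE G0 (A, B)).1 Zx.
have sy : seq_sum y.1 = seq_sum y.2.
  rewrite /seq_sum !big_seq_mset !sum_seg ?(ltnW lt12) //.
  by rewrite -!/(pre _ _); move: gaps; lia.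
have Zy : eqsumP G0 y.
  apply/eqsumPE; split=> // g; rewrite mem => /mem_drop /mem_take;
    [exact: ZA|exact: ZB].
have Zz : eqsumP G0 z.
  apply/eqsumPE; split=> [g|g|].
  - by rewrite mem mem_cat => /orP[/mem_take|/mem_drop]; exact: ZA.
  - by rewrite mem mem_cat => /orP[/mem_take|/mem_drop]; exact: ZB.
  - have eA : A = y.1 + z.1 := congr1 fst xyz.
    have eB : B = y.2 + z.2 := congr1 snd xyz.
    by move: eAB; rewrite eA eB !seq_sumD sy => /addrI.
(* Neither part is trivial: [y.2] has [j2 - j1] terms, and [z.2] contains the terms of [b] from the
   proper index [j2] on. *)
case: (irr _ _ Zy Zz xyz) => /(congr1 snd) /(congr1 (fun m : {mset int} => size m));
  rewrite /= size_seq_mset size_m0 => /eqP.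
  by rewrite size_drop size_takel ?(ltnW (ltn_ord j2)) // subn_eq0 leqNgt lt12.
by rewrite size_cat addn_eq0 size_drop subn_eq0 leqNgt ltn_ord andbF.
Qed.

End Lambert.

(** * Chains of factorizations in the monoid of zero-sum multisets *)

Lemma big_flatten_mkseq (V : nmodType) k (W : nat -> seq V) :
  \sum_(u <- flatten (mkseq W k)) u = \sum_(j < k) \sum_(u <- W j) u.
Proof. by rewrite big_flatten big_map -{1}[k]subn0 -/(index_iota 0 k) big_mkord. Qed.

Lemma big_mkseq (V : nmodType) k (u : nat -> V) :
  \sum_(v <- mkseq u k) v = \sum_(j < k) u j.
Proof. by rewrite big_map -{1}[k]subn0 -/(index_iota 0 k) big_mkord. Qed.

Lemma mem_msum (K : choiceType) k (F : nat -> {mset K}) (e : K) :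
  e \in (\sum_(j < k) F j : {mset K}) -> exists2 j, (j < k)%N & e \in F j.
Proof.
rewrite in_mset msumE lt0n sum_nat_eq0 negb_forall => /existsP[j].
by rewrite implyTb -lt0n => ej; exists j; rewrite ?ltn_ord // in_mset.
Qed.

Lemma msub_bigsum (K L : choiceType) (F : K -> {mset L}) (A B : {mset K}) :
  (A `<=` B)%mset -> (\sum_(a <- A) F a `<=` \sum_(a <- B) F a)%mset.
Proof. by move=> /msubK <-; rewrite big_madd msub_add. Qed.

Lemma msub_mem (K L : choiceType) (F : K -> {mset L}) (A : {mset K}) a :
  a \in A -> (F a `<=` \sum_(b <- A) F b)%mset.
Proof. by move=> aA; rewrite -(big_m1 F a); apply: msub_bigsum; rewrite msub1set. Qed.

Lemma msetIB (K : choiceType) (A B : {mset K}) :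
  (A `&` B)%mset + (A `\` B)%mset = A.
Proof. by apply/msetP => a; rewrite maddE !msetE2; mlia. Qed.

Lemma count_le_sum (T : Type) (a : pred T) (s : seq T) (f : T -> nat) :
  (forall x, a x -> (0 < f x)%N) -> (count a s <= \sum_(x <- s) f x)%N.
Proof.
move=> af; rewrite -sum1_count big_mkcond /=; apply: leq_sum => x _.
by case: ifP => // /af.
Qed.

(** * Zero-sum multisets of weighted primes and their nonnegative part *)

Section Weights.
Variables (P : choiceType) (w : P -> int).
Implicit Types (u v x X : {mset P}) (s t y : seq {mset P}).

Definition wsum u : int := \sum_(p <- u) w p.
Definition zerosum u : Prop := wsum u = 0.
Definition zatom : {mset P} -> Prop := relatom zerosum.
(** Primes of weight 0 are kept as well: each is an atom by itself, and its size thus corresponds to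
    the sum of |S^+| and v_0(S). *)
Definition pos u : {mset P} := seq_mset [seq p <- u | 0 <= w p].
(* In a factorization of maximal length every atom has this property. *)
Definition good v : Prop := zerosum v /\ size (pos v) = 1%N.

Let cl := mmap w.
Let G0 : set int := negative (range w).

Lemma posE u p : pos u p = if 0 <= w p then u p else 0%N.
Proof.
rewrite mset_seqE count_filter -[in RHS]count_mem_mset.
case: ifP => wp; last first.
  by rewrite -(count_pred0 u); apply: eq_count => q /=; case: eqP => //= ->; rewrite wp.
by apply: eq_count => q /=; case: eqP => //= ->; rewrite wp.
Qed.

Lemma posD : {morph pos : u v / u + v}.
Proof. by move=> u v; apply/msetP => p; rewrite maddE !posE maddE; case: ifP. Qed.

Lemma pos0 : pos 0 = 0.
Proof. by apply/msetP => p; rewrite posE madd0E if_same. Qed.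

Lemma wsumD : {morph wsum : u v / u + v}.
Proof. by move=> u v; rewrite /wsum big_madd. Qed.

Lemma wsum0 : wsum 0 = 0.
Proof. exact: big_m0. Qed.

Lemma seq_sum_cl u : seq_sum (cl u) = wsum u.
Proof. exact: big_mmap. Qed.

Lemma zerosum_pos0 u : zerosum u -> pos u = 0 -> u = 0.
Proof.
move=> zu pu; apply/eqP; rewrite -size_mset_eq0 size_eq0; apply: contraT => u0.
have : wsum u < 0.
  rewrite /wsum -(big_map w xpredT (fun g => g)); apply: sum_lt0.
    by move: u0; rewrite -!size_eq0 size_map.
  move=> g /mapP[p pu' ->]; rewrite ltNge; apply: contraL pu' => wp.
  rewrite -mset_eq0; have : pos u p = 0%N by rewrite pu madd0E.
  by rewrite posE wp => ->.
by rewrite zu ltxx.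
Qed.

(** In a splitting into two zero-sum parts, one part has no nonnegative prime; its sum would be
    negative unless it is empty. *)
Lemma good_zatom v : good v -> zatom v.
Proof.
move=> [zv pv]; split=> // [v0|b c zb zc vbc].
  by move: pv; rewrite v0 pos0 size_m0.
move: pv; rewrite vbc posD size_madd => pbc.
have [/size_meq0 pb|/size_meq0 pc] : size (pos b) = 0%N \/ size (pos c) = 0%N by lia.
  by left; apply: zerosum_pos0.
by right; apply: zerosum_pos0.
Qed.

Lemma zatom_pos u : zatom u -> (0 < size (pos u))%N.
Proof.
move=> [zu u0 _]; rewrite lt0n; apply/eqP => /size_meq0 pu.
by apply: u0; apply: zerosum_pos0.
Qed.

Lemma size_posE u : size (pos u) = count (fun g => 0 <= g) (cl u).
Proof.
by rewrite (permP (perm_eq_seq_mset _)) count_map size_seq_mset size_filter.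
Qed.

Lemma good_cl u v : cl u = cl v -> good v -> good u.
Proof.
by move=> e [zv pv]; split; rewrite ?size_posE ?e -?size_posE //
  /zerosum -seq_sum_cl e seq_sum_cl.
Qed.

Lemma cl_pos u g : 0 <= g -> cl u g = cl (pos u) g.
Proof.
move=> g0; rewrite !mset_seqE !count_map.
rewrite (permP (perm_eq_seq_mset _)) count_filter; apply: eq_count => p /=.
by case: eqP => //= ->.
Qed.

Lemma cl_diff_neg u v g : pos u = pos v -> g \in (cl u `\` cl v)%mset -> G0 g.
Proof.
move=> puv; rewrite in_msetB => lt; split=> /=.
  have : g \in cl u by rewrite in_mset; apply: leq_ltn_trans lt.
  by move=> /mem_mmap[p _ ->]; exists p.
by rewrite ltNge; apply/negP => g0; move: lt;
  rewrite (cl_pos u g0) (cl_pos v g0) puv ltnn.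
Qed.

Lemma pos_neg X : (forall g, g \in cl X -> g < 0) -> pos X = 0.
Proof.
move=> neg; apply/msetP => p; rewrite posE madd0E; case: ifP => // wp.
apply/eqP; rewrite mset_eq0; apply/negP => /(mmap_f w) /neg.
by rewrite ltNge wp.
Qed.

(** Both sums vanish, so removing the common classes leaves equal sums; the remaining classes are
    negative because the nonnegative primes agree. *)
Lemma eqsum_diff u v : zerosum u -> zerosum v -> pos u = pos v ->
  eqsumP G0 (cl u `\` cl v, cl v `\` cl u)%mset.
Proof.
move=> zu zv puv; apply/eqsumPE; split=> [g|g|] /=.
- exact: cl_diff_neg.
- exact: cl_diff_neg (esym puv).
apply: (addrI (seq_sum (cl u `&` cl v)%mset)).
by rewrite -seq_sumD msetIB msetIC -seq_sumD msetIB !seq_sum_cl zu zv.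
Qed.

(** A nonempty sequence of negative integers has nonzero sum, so if one component is empty then so
    is the other. *)
Lemma eqsum_atom_neq0 e : relatom (eqsumP G0) e -> e.1 <> 0 /\ e.2 <> 0.
Proof.
case: e => A B [/eqsumPE[/= nA nB sAB] e0 _].
have nz (C : {mset int}) : (forall g, g \in C -> G0 g) -> seq_sum C = 0 -> C = 0.
  move=> nC; apply: contraPP => /eqP; rewrite -size_mset_eq0 size_eq0 => C0.
  by apply/eqP; rewrite lt_eqF //; apply: sum_lt0 => // g /nC[].
have s0 : seq_sum 0 = 0 by exact: big_m0.
split=> /= z; apply: e0; move: sAB; rewrite z s0.
  by move=> /esym /(nz _ nB) ->.
by move=> /(nz _ nA) ->.
Qed.

End Weights.

Section Exchange.
Variables (P : choiceType) (w : P -> int).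
Implicit Types (u v x X : {mset P}) (s t y : seq {mset P}).

Let cl := mmap w.
Let G0 : set int := negative (range w).

(* Exchanging X for X' in the atom u: every atom of the result meets X', since
   it would otherwise be a proper part of u. *)
Lemma exchange u v X X' (E : {mset {mset int} * {mset int}}) :
  zatom w u -> pos w u = pos w v ->
  (forall e, e \in E -> relatom (eqsumP G0) e) ->
  \sum_(e <- E) e.1 = cl X -> \sum_(e <- E) e.2 = cl X' ->
  (X `<=` u)%mset -> (cl X `<=` cl u `\` cl v)%mset ->
  (cl X' `<=` cl v `\` cl u)%mset ->
  exists W : seq {mset P},
    [/\ [/\ {in W, forall a, zatom w a}, W <> [::] & \sum_(a <- W) a + X = u + X'],
        E = 0 -> W = [:: u], E <> 0 -> (size W <= size X')%N,
        pos w (\sum_(a <- W) a) = pos w u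
      & (size (cl v `\` cl (\sum_(a <- W) a)%R)%mset + size X')%N
        = size (cl v `\` cl u)%mset].
Proof.
move=> au puv AE e1 e2 Xu Xc Xc'.
have [zu u0 irru] := au.
(* The classes of [X'] are missing from [u] and those of [X] are surplus, so the deficit against [v]
   drops by exactly the size of [X']. *)
have measure n : n + X = u + X' ->
    (size (cl v `\` cl n)%mset + size X')%N = size (cl v `\` cl u)%mset.
  move=> en; rewrite -(size_mmap w X') -size_madd; congr (size (_ : {mset int})).
  have {}en : cl n + cl X = cl u + cl X' by rewrite -!mmapD en.
  apply/msetP => g; move/msetP/(_ g): en; move/msubsetP/(_ g): Xc.
  move/msubsetP/(_ g): Xc'; rewrite !maddE !msetE2 -/cl; mlia.
have [E0|En0] := eqVneq E 0.
  move: e1 e2; rewrite E0 !big_m0 => /esym/mmap_eq0 X0 /esym/mmap_eq0 X'0.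
  exists [:: u]; rewrite big_seq1; split=> //.
    by split=> //; [move=> a; rewrite inE => /eqP->|rewrite X0 X'0].
  by apply: measure; rewrite X0 X'0.
have [e eE] : exists e, e \in E.
  by have [E0|[e eE]] := mset_0Vmem E; [rewrite E0 eqxx in En0|exists e].
have [ne1 ne2] := eqsum_atom_neq0 (AE e eE).
have X0 : X <> 0.
  move=> X0; apply: ne1; move/msubsetP: (msub_mem fst eE); rewrite e1 X0 /cl mmap0 => le.
  by apply/msetP => g; have := le g; rewrite madd0E leqn0 => /eqP.
have X'0 : X' <> 0.
  move=> X'0; apply: ne2; move/msubsetP: (msub_mem snd eE);
    rewrite e2 X'0 /cl mmap0 => le.
  by apply/msetP => g; have := le g; rewrite madd0E leqn0 => /eqP.
have wX : wsum w X = wsum w X'.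
  rewrite -!seq_sum_cl -/cl -e1 -e2 /seq_sum !big_msum.
  apply: eq_big_seq => d /AE[/eqsumPE[_ _ h] _ _]; exact: h.
pose n := (u `\` X)%mset + X'.
have en : n + X = u + X' by rewrite /n addrAC [_ + X]addrC msubK.
have zn : zerosum w n.
  by apply: (addIr (wsum w X)); rewrite -wsumD en wsumD zu wX.
have [W [AW eW]] := relatom_factor (@size_madd P) (@size_meq0 P) zn.
have X'n : (X' `<=` \sum_(j < size W) nth 0 W j)%mset.
  have -> : \sum_(j < size W) nth 0 W j = n by rewrite -eW (big_nth 0) big_mkord.
  by rewrite /n addrC msub_add.
have [G [GW eG]] := msub_sumP X'n.
(* An atom receiving nothing of [X'] would lie inside [u] minus [X]; as a zero-sum part of the atom
   [u] it would be all of [u], so [X] would be empty. *)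
have G0' (j : 'I_(size W)) : G j <> 0.
  move=> Gj0; have Wj := AW _ (mem_nth 0 (ltn_ord j)).
  have [zj j0 _] := Wj.
  have ju : (nth 0 W j `<=` u `\` X)%mset.
    have eB : \sum_(i < size W) (nth 0 W i `\` G i)%mset = (u `\` X)%mset.
      apply: (@addmI _ X'); rewrite [RHS]addrC -/n -eW (big_nth 0) big_mkord.
      rewrite -{1}eG -big_split /=; apply: eq_bigr => i _.
      exact/msubK/GW.
    rewrite -eB (bigD1 j) //= Gj0 (_ : (_ `\` 0)%mset = nth 0 W j) ?msub_add //.
    exact: msetB0.
  have ju' : (nth 0 W j `<=` u)%mset by apply: msubset_trans ju _; exact: msubsetDl.
  have eu := msubK ju'.
  have zr : zerosum w (u `\` nth 0 W j)%mset.
    by move: zu; rewrite -{1}eu /zerosum wsumD zj add0r.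
  have [//|r0] := irru _ _ zj zr (esym eu).
  apply: X0; move: eu; rewrite r0 addr0 => eu; move/msubsetP: ju => le.
  apply/msetP => p; have := le p; move/msubsetP/(_ p): Xu.
  by rewrite eu msetE2 madd0E; mlia.
exists W; rewrite eW; split.
- split=> //; move=> W0; apply: X'0; move: eW; rewrite W0 big_nil => /esym.
  by case/madd_eq0.
- by move=> E0; rewrite E0 eqxx in En0.
- move=> _; rewrite -eG size_msum -{1}[size W]card_ord -sum1_card.
  apply: leq_sum => j _; rewrite lt0n; apply/eqP => /size_meq0; exact: G0'.
- have pX : pos w X = 0.
    by apply: pos_neg => g /(msubset_subset Xc) /(cl_diff_neg puv)[].
  have pX' : pos w X' = 0.
    by apply: pos_neg => g /(msubset_subset Xc') /(cl_diff_neg (esym puv))[].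
  by move: (congr1 (pos w) en); rewrite !posD pX pX' !addr0.
- exact: measure.
Qed.

End Exchange.

(** * One exchange step, governed by the relative Davenport constant *)

Section ClassStep.
Variables (P : choiceType) (w : P -> int).
Implicit Types (u v x X : {mset P}) (s t y : seq {mset P}).

Let cl := mmap w.
Let G0 : set int := negative (range w).

(** The parts [s1] and [t1] may still share atoms, since cancelling these only lowers the distance.
    Atoms are demanded of [t] alone because [s] is the factorization already reached. *)
Definition fact_step (B : nat) s t : Prop := exists c s1 t1,
  [/\ perm_eq s (c ++ s1), perm_eq t (c ++ t1),
      (size s1 <= B)%N /\ (size t1 <= B)%N, (size s <= size t)%N
    & {in t, forall a, zatom w a} /\ \sum_(a <- s) a = \sum_(a <- t) a].

Lemma choice_lt (T : Type) (t0 : T) k (R : nat -> T -> Prop) :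
  (forall j, (j < k)%N -> exists b, R j b) ->
  exists f : nat -> T, forall j, (j < k)%N -> R j (f j).
Proof.
move=> ex; have [j|f fP] := @choice _ _ (fun j b => (j < k)%N -> R j b).
  by case: (ltnP j k) => [/ex[b bR]|_]; [exists b|exists t0].
by exists f.
Qed.

Lemma perm_mkseq_split (T : eqType) (a : pred nat) (f : nat -> T) k :
  perm_eq (mkseq f k)
    (map f (filter a (iota 0 k)) ++ map f (filter (predC a) (iota 0 k))).
Proof. by rewrite -map_cat perm_map // perm_sym perm_filterC. Qed.

(** The [u j] are the atoms of a factorization, the [v j] their targets. The last conclusion
    supplies the measure for an induction: the number of target classes still missing. The
    conditions on [W j] keep the grouping usable when the length does not change. *)
Lemma class_step (M N : nat) x k (u v : nat -> {mset P}) :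
  davenport_bound (diag_pairs G0) N ->
  (forall p, p \in x -> w p < 0 -> - M%:Z <= w p) ->
  (forall j, (j < k)%N -> zatom w (u j)) ->
  (forall j, (j < k)%N -> zerosum w (v j)) ->
  (forall j, (j < k)%N -> pos w (u j) = pos w (v j)) ->
  \sum_(j < k) u j = x -> \sum_(j < k) v j = x ->
  (exists2 j, (j < k)%N & cl (u j) <> cl (v j)) ->
  exists W : nat -> seq {mset P},
    [/\ forall j, (j < k)%N -> W j <> [::],
        forall j, (j < k)%N -> pos w (\sum_(a <- W j) a) = pos w (u j),
        fact_step (maxn (M * N) 2) (mkseq u k) (flatten (mkseq W k))
      & (\sum_(j < k) size (cl (v j) `\` cl (\sum_(a <- W j) a)%R)%mset
         < \sum_(j < k) size (cl (v j) `\` cl (u j))%mset)%N].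
Proof.
move=> dav xM Au Zv puv su sv [j0 j0k ne0].
have /(choice_lt 0)[F FP] : forall j, (j < k)%N ->
    exists F : {mset {mset int} * {mset int}},
    [/\ forall e, e \in F -> relatom (eqsumP G0) e,
        \sum_(e <- F) e.1 = (cl (u j) `\` cl (v j))%mset
      & \sum_(e <- F) e.2 = (cl (v j) `\` cl (u j))%mset].
  move=> j jk; have [zu _ _] := Au j jk.
  have [s [As es]] := eqsum_factor (eqsum_diff zu (Zv j jk) (puv j jk)).
  exists (seq_mset s); rewrite !big_seq_mset -fst_sum -snd_sum es; split=> // e.
  by rewrite (perm_mem (perm_eq_seq_mset s)); exact: As.
(* Both families sum to [x], so over all groups the surplus classes and the missing classes agree:
   the total of the pairs lies in S(G0), though single pairs need not. *)
have sI : \sum_(j < k) (cl (u j) `\` cl (v j))%mset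
        = \sum_(j < k) (cl (v j) `\` cl (u j))%mset.
  apply: (@addmI _ (\sum_(j < k) (cl (u j) `&` cl (v j))%mset)).
  rewrite -[LHS]big_split -[RHS]big_split /=.
  under eq_bigr do rewrite msetIB.
  under [RHS]eq_bigr do rewrite msetIC msetIB.
  by rewrite -!mmap_sum su sv.
pose z : {mset {mset int} * {mset int}} := \sum_(j < k) F j.
have Az e : e \in z -> relatom (eqsumP G0) e.
  by move=> /mem_msum[j jk]; have [AF _ _] := FP j jk; exact: AF.
have ez : \sum_(e <- z) e.1 = \sum_(e <- z) e.2.
  rewrite !big_msum; transitivity (\sum_(j < k) (cl (u j) `\` cl (v j))%mset).
    by apply: eq_bigr => j _; have [] := FP j (ltn_ord j).
  by rewrite sI; apply: eq_bigr => j _; have [_ _ ->] := FP j (ltn_ord j).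
have z0 : z <> 0.
  move=> z0; apply: ne0; have Fj0 : F j0 = 0.
    apply: size_meq0; move: (msum_eq0 z0) => /eqP.
    by rewrite sum_nat_eq0 => /forallP/(_ (Ordinal j0k)) /eqP.
  have [_] := FP j0 j0k; rewrite Fj0 !big_m0 => e1 e2.
  by rewrite -[LHS](msetIB _ (cl (v j0))) -[RHS](msetIB _ (cl (u j0))) msetIC -e1 -e2.
have [z' [z'0 z'z ez' sz']] := davenport_sub dav z0 Az ez.
have Az' e : e \in z' -> relatom (eqsumP G0) e by move=> /(msubset_subset z'z)/Az.
have [E [EF sE]] := msub_sumP z'z.
have AE j e : (j < k)%N -> e \in E j -> relatom (eqsumP G0) e.
  by move=> jk /(msubset_subset (EF j jk)); have [AF _ _] := FP j jk; exact: AF.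
have B1 j : (j < k)%N -> (\sum_(e <- E j) e.1 `<=` cl (u j) `\` cl (v j))%mset.
  by move=> jk; have [_ <- _] := FP j jk; apply/msub_bigsum/EF.
have B2 j : (j < k)%N -> (\sum_(e <- E j) e.2 `<=` cl (v j) `\` cl (u j))%mset.
  by move=> jk; have [_ _ <-] := FP j jk; apply/msub_bigsum/EF.
have /(choice_lt 0)[X XP] : forall j, (j < k)%N -> exists X : {mset P},
    (X `<=` u j)%mset /\ cl X = \sum_(e <- E j) e.1.
  move=> j jk.
  have [|X X1 X2] := @mmap_lift _ _ w (u j) (\sum_(e <- E j) e.1); last by exists X.
  by apply: msubset_trans (B1 j jk) _; exact: msubsetDl.
(* As [z'] has its value in S(G0), the removed primes have exactly the classes to be inserted, so
   they can be dealt out again and no prime of [x] is gained or lost. *)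
have [X' [X'P sX']] : exists X' : nat -> {mset P},
    (forall j, (j < k)%N -> cl (X' j) = \sum_(e <- E j) e.2)
    /\ \sum_(j < k) X' j = \sum_(j < k) X j.
  apply: mmap_split; rewrite mmap_sum -big_msum sE -ez' -sE big_msum.
  by apply: eq_bigr => j _; have [_] := XP j (ltn_ord j).
have /(choice_lt [::])[W WP] : forall j, (j < k)%N -> exists W : seq {mset P},
    [/\ [/\ {in W, forall a, zatom w a}, W <> [::]
          & \sum_(a <- W) a + X j = u j + X' j],
        E j = 0 -> W = [:: u j], E j <> 0 -> (size (W) <= size (X' j))%N,
        pos w (\sum_(a <- W) a) = pos w (u j)
      & (size (cl (v j) `\` cl (\sum_(a <- W) a)%R)%mset + size (X' j))%N
        = size (cl (v j) `\` cl (u j))%mset].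
  move=> j jk; have [Xu eX] := XP j jk.
  apply: (exchange (E := E j)) => //; rewrite -/cl.
  - exact: Au.
  - exact: puv.
  - by move=> e; apply: AE.
  - by rewrite X'P.
  - by rewrite eX; exact: B1.
  - by rewrite X'P //; exact: B2.
have sizeX' : (\sum_(j < k) size (X' j) = \sum_(e <- z') size (e.2 : {mset int}))%N.
  transitivity (size (\sum_(e <- z') e.2 : {mset int})%R); last by rewrite size_msum.
  rewrite -sE big_msum size_msum; apply: eq_bigr => j _.
  by rewrite -X'P ?ltn_ord // size_mmap.
(* First components consist of classes of primes occurring in [x], as Lambert's bound requires. *)
have bound e g : e \in z' -> g \in e.1 -> g < 0 /\ - M%:Z <= g.
  move=> ez1 ge; have [/eqsumPE[n1 _ _] _ _] := Az' e ez1.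
  have g0 : g < 0 by have [] := n1 g ge.
  split=> //; move/(msubset_subset z'z): ez1 => /mem_msum[j jk eF].
  have [_ e1 _] := FP j jk; have /msubset_subset := msub_mem fst eF.
  rewrite e1 => /(_ g ge) gC.
  have : g \in cl (u j) by move: gC; apply: msubset_subset; exact: msubsetDl.
  move=> /mem_mmap[p pu eg]; rewrite eg in g0 *; apply: xM => //.
  by rewrite -su (bigD1 (Ordinal jk)) //= mem_madd pu.
have size2 e : e \in z' -> (size (e.2 : {mset int}) <= M)%N.
  move=> ez1; apply: (eqsum_atom_size (Az' e ez1)) => [g|g ge].
    exact: bound.
  by have [/eqsumPE[_ n2 _] _ _] := Az' e ez1; have [] := n2 g ge.
have size2_gt0 e : e \in z' -> (0 < size (e.2 : {mset int}))%N.
  move=> /Az' /eqsum_atom_neq0[_ n2]; rewrite lt0n; apply/eqP => /size_meq0 //.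
have [e0 e0z'] : exists e, e \in z'.
  by have [//|[e ez1]] := mset_0Vmem z'; exists e.
have X'gt0 : (0 < \sum_(j < k) size (X' j))%N.
  rewrite sizeX' (big_rem e0) //= addn_gt0 size2_gt0 //.
have X'le : (\sum_(j < k) size (X' j) <= M * N)%N.
  rewrite sizeX'; apply: (@leq_trans (\sum_(e <- z') M)%N).
    rewrite big_seq [leqRHS]big_seq; apply: leq_sum => e; exact: size2.
  by rewrite big_const_seq count_predT iter_addn_0 leq_mul2l sz' orbT.
(* Positivity of [M] lets the number of replaced atoms, which is at most [N], be bounded by the
   product of [M] and [N]. *)
have M0 : (0 < M)%N by apply: leq_trans (size2_gt0 _ e0z') (size2 _ e0z').
exists W; split.
- by move=> j /WP[[]].
- by move=> j /WP[].
(* Groups with no share of [z'] keep their atom and form the common part of the step. *)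
- pose a j := E j == 0; pose I := iota 0 k.
  have ordsum (f : nat -> nat) : (\sum_(j < k) f j = \sum_(j <- I) f j)%N.
    by rewrite -(big_mkord xpredT f) /index_iota subn0.
  have Ik j : j \in I -> (j < k)%N by rewrite mem_iota.
  exists (map u (filter a I)), (map u (filter (predC a) I)),
    (flatten (map W (filter (predC a) I))).
  have W0 : flatten (map W (filter a I)) = map u (filter a I).
    rewrite (_ : map W _ = map (fun j => [:: u j]) (filter a I)).
      by elim: (filter a I) => //= j r ->.
    apply/eq_in_map => j; rewrite mem_filter => /andP[/eqP Ej /Ik jk].
    by have [_ ->] := WP j jk.
  split.
  + exact: perm_mkseq_split.
  + by rewrite -W0 -flatten_cat perm_flatten // perm_mkseq_split.
  + split.
      rewrite size_map size_filter; apply: (@leq_trans N); last first.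
        by rewrite leq_max leq_pmull.
      apply: leq_trans sz'; rewrite -sE size_msum.
      rewrite (ordsum (fun j => size (E j))).
      apply: count_le_sum => j; rewrite lt0n /= => Ej.
      by apply: contraNN Ej => /eqP/size_meq0/eqP.
    rewrite size_flatten /shape -map_comp sumn_map big_filter.
    rewrite leq_max; apply/orP; left; apply: leq_trans X'le.
    rewrite (ordsum (fun j => size (X' j))).
    rewrite big_mkcond big_seq [leqRHS]big_seq /=; apply: leq_sum => j /Ik jk.
    case: ifP => // /eqP Ej; by have [_ _ ->] := WP j jk.
  + rewrite size_mkseq size_flatten /shape /mkseq -map_comp sumn_map.
    rewrite -{1}(size_iota 0 k) -sum1_size big_seq [leqRHS]big_seq.
    apply: leq_sum => j /Ik jk /=; have [[_ Wj _] _ _ _ _] := WP j jk.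
    by case: (W j) Wj.
  + split.
      move=> b /flattenP[s /mapP[j /Ik jk ->]]; have [[AW _ _] _ _ _ _] := WP j jk.
      exact: AW.
    rewrite big_mkseq big_flatten_mkseq; apply: (@addIm _ (\sum_(j < k) X j)) => /=.
    rewrite -{1}sX' -!big_split /=; apply: eq_bigr => j _.
    by have [[_ _ ->]] := WP j (ltn_ord j).
- rewrite -(ltn_add2r (\sum_(j < k) size (X' j))) -big_split /=.
  rewrite (eq_bigr (fun j : 'I_k => size (cl (v j) `\` cl (u j))%mset)).
    by rewrite -[ltnLHS]addn0 ltn_add2l.
  by move=> j _; have [_ _ _ _ ->] := WP j (ltn_ord j).
Qed.

End ClassStep.

(** * Chains of steps leading to a factorization of maximal length *)

Section Chains.
Variables (P : choiceType) (w : P -> int).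
Implicit Types (u v x A : {mset P}) (s t y : seq {mset P}).

Let cl := mmap w.
Let G0 : set int := negative (range w).

(** Sequences stand for multisets of atoms, hence the final permutation. *)
Inductive fact_chain (B : nat) : seq {mset P} -> seq {mset P} -> Prop :=
| fact_chain_perm s t : perm_eq s t -> fact_chain B s t
| fact_chain_step s t y : fact_step w B s t -> fact_chain B t y -> fact_chain B s y.

Lemma fact_chain_permr B s t y : fact_chain B s t -> perm_eq t y -> fact_chain B s y.
Proof.
elim=> [s' t' st ty|s' t' y' st _ IH /IH ty].
  exact/fact_chain_perm/(perm_trans st ty).
exact: fact_chain_step st ty.
Qed.

Lemma size_msub (K : choiceType) (A B : {mset K}) :
  (A `<=` B)%mset -> (size A <= size B)%N.
Proof. by move=> /msubK <-; rewrite size_madd leq_addr. Qed.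

Lemma cl_diff u v : cl u = cl v -> cl (u `\` v)%mset = cl (v `\` u)%mset.
Proof.
move=> e; apply: (@addmI _ (cl (u `&` v)%mset)).
by rewrite -!mmapD msetIB msetIC msetIB.
Qed.

(** Induction on the number of misplaced primes. A prime missing from one group is exchanged for a
    surplus prime of the same class there; classes are unchanged, so all groups remain atoms. *)
Lemma swap_chain (B k : nat) (u v : nat -> {mset P}) : (2 <= B)%N ->
  (forall j, (j < k)%N -> good w (v j)) ->
  (forall j, (j < k)%N -> cl (u j) = cl (v j)) ->
  \sum_(j < k) u j = \sum_(j < k) v j ->
  fact_chain B (mkseq u k) (mkseq v k).
Proof.
move=> B2 gv; have [m] := ubnP (\sum_(j < k) size (v j `\` u j)%mset)%N.
elim: m u => // m IHm u; rewrite ltnS => lem cuv suv.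
have [[j jk ujv]|same] := pselect (exists2 j, (j < k)%N & u j <> v j); last first.
  apply: fact_chain_perm; rewrite (_ : mkseq u k = mkseq v k) //.
  apply/eq_in_map => j; rewrite mem_iota => jk.
  by apply: contrapT => ne; apply: same; exists j.
have su i : (i < k)%N -> size (u i) = size (v i).
  by move=> ik; rewrite -(size_mmap w) -/cl cuv // size_mmap.
have [q qv] : exists q, q \in (v j `\` u j)%mset.
  have [vu0|[q qv]] := mset_0Vmem (v j `\` u j)%mset; last by exists q.
  have vu : (v j `<=` u j)%mset by rewrite -msetB_eq0 vu0.
  case: ujv; rewrite -{1}(msubK vu) (_ : (u j `\` v j)%mset = 0) ?addr0 //.
  apply: size_meq0; have := su j jk; rewrite -{1}(msubK vu) size_madd; lia.
have [q' q'u wq] : exists2 q', q' \in (u j `\` v j)%mset & w q = w q'.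
  by apply: mem_mmap; rewrite -/cl cl_diff ?cuv //; apply: mmap_f.
move: qv q'u; rewrite !in_msetB => qv q'u.
(* The total multiplicity of [q] is the same on both sides, so its lack in group [j] is offset by an
   excess elsewhere. *)
have [l lk ql] : exists2 l, (l < k)%N & (v l q < u l q)%N.
  apply: contrapT => nl; move/msetP/(_ q): suv; rewrite !msumE => e.
  have : (\sum_(i < k) u i q < \sum_(i < k) v i q)%N; last by rewrite e ltnn.
  rewrite (bigD1 (Ordinal jk)) // [ltnRHS](bigD1 (Ordinal jk)) //=.
  rewrite -addSn leq_add //; apply: leq_sum => i _; rewrite leqNgt.
  by apply/negP => lt; apply: nl; exists i.
have lj : l != j by apply/eqP => lj; move: ql; rewrite lj; lia.
pose u' i := if i == j then (u j `\` [mset q'])%mset + [mset q]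
             else if i == l then (u l `\` [mset q])%mset + [mset q'] else u i.
have u'j : u' j = (u j `\` [mset q'])%mset + [mset q] by rewrite /u' eqxx.
have u'l : u' l = (u l `\` [mset q])%mset + [mset q'] by rewrite /u' (negbTE lj) eqxx.
have u'i i : i != j -> i != l -> u' i = u i by rewrite /u' => /negbTE-> /negbTE->.
have uj : [mset q'] + (u j `\` [mset q'])%mset = u j.
  by apply: msubK; rewrite msub1set in_mset; apply: leq_ltn_trans q'u.
have ul : [mset q] + (u l `\` [mset q])%mset = u l.
  by apply: msubK; rewrite msub1set in_mset; apply: leq_ltn_trans ql.
have cu' i : (i < k)%N -> cl (u' i) = cl (v i).
  move=> ik; rewrite -cuv //; have [->|ij] := eqVneq i j.
    by rewrite u'j -[in RHS]uj /cl !mmapD !mmap1 wq addrC.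
  have [->|il] := eqVneq i l; last by rewrite u'i.
  by rewrite u'l -[in RHS]ul /cl !mmapD !mmap1 wq addrC.
pose oj := Ordinal jk; pose ol := Ordinal lk.
have olj : ol != oj by rewrite -val_eqE.
have s' : \sum_(i < k) u' i = \sum_(i < k) u i.
  rewrite (bigD1 oj) // (bigD1 ol) //= [RHS](bigD1 oj) // [in RHS](bigD1 ol) //=.
  rewrite !addrA; congr (_ + _).
    by rewrite u'j u'l -[in RHS]uj -[in RHS]ul addrACA
      [RHS]addrACA addrC [[mset q'] + _]addrC.
  by apply: eq_bigr => i /andP[ij il]; rewrite u'i.
apply: (fact_chain_step (t := mkseq u' k)).
  pose a i := (i != j) && (i != l).
  have ua : map u' (filter a (iota 0 k)) = map u (filter a (iota 0 k)).
    by apply/eq_in_map => i; rewrite mem_filter => /andP[/andP[ij il] _]; rewrite u'i.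
  exists (map u (filter a (iota 0 k))), (map u (filter (predC a) (iota 0 k))),
    (map u' (filter (predC a) (iota 0 k))).
  have c2 : (count (predC a) (iota 0 k) <= B)%N.
    apply: leq_trans B2; rewrite -addn1.
    apply: (@leq_trans (count (predU (pred1 j) (pred1 l)) (iota 0 k))).
      by apply: sub_count => i /=; rewrite /a negb_and !negbK.
    rewrite -(leq_add2r (count (predI (pred1 j) (pred1 l)) (iota 0 k))) count_predUI.
    by rewrite !count_uniq_mem ?iota_uniq //; do 2 case: (_ \in _).
  split.
  - exact: perm_mkseq_split.
  - by rewrite -ua; exact: perm_mkseq_split.
  - by rewrite !size_map size_filter.
  - by rewrite !size_mkseq.
  - split; last by rewrite !big_mkseq s'.
    move=> b /mapP[i]; rewrite mem_iota => ik ->.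
    by apply/good_zatom/(good_cl (cu' i ik))/gv.
apply: IHm => //; last by rewrite s'.
apply: leq_trans lem.
(* Group [j] now lacks one prime fewer; group [l] lacks no more than before, as [q] was in excess
   there. *)
rewrite (bigD1 oj) // (bigD1 ol) //= [ltnRHS](bigD1 oj) // [in ltnRHS](bigD1 ol) //=.
rewrite -addSn; apply: leq_add.
  rewrite u'j (_ : (v j `\` u j)%mset =
    (v j `\` ((u j `\` [mset q'])%mset + [mset q]))%mset + [mset q]).
    by rewrite size_madd enum_msetn addn1.
  apply/msetP => p; rewrite !(maddE, msetE2, msetnE); move: qv q'u.
  by case: eqVneq => [->|_]; case: eqVneq => [->|_]; mlia.
apply: leq_add; last by apply: leq_sum => i /andP[ij il]; rewrite u'i.
apply/size_msub/msubsetP => p; rewrite u'l !(maddE, msetE2, msetnE); move: ql.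
by case: eqVneq => [->|_]; case: eqVneq => [->|_]; mlia.
Qed.

(** Running through [y], an element is taken when its single nonnegative prime is still wanted in
    [A]. *)
Lemma pick_group A y : (forall v, v \in y -> size (pos w v) = 1%N) ->
  (A `<=` pos w (\sum_(v <- y) v))%mset ->
  exists Y R, perm_eq y (Y ++ R) /\ pos w (\sum_(v <- Y) v) = A.
Proof.
elim: y A => [|v y IHy] A y1 le.
  exists [::], [::]; split=> //; move: le; rewrite big_nil pos0 => /msubsetP le.
  by apply/msetP => p; have := le p; rewrite madd0E leqn0 => /eqP ->.
have y1' v' : v' \in y -> size (pos w v') = 1%N.
  by move=> v'y; apply: y1; rewrite inE v'y orbT.
have v1 := y1 v (mem_head _ _).
have [p pv] : exists p, pos w v = [mset p].
  have [v0|[p pv]] := mset_0Vmem (pos w v); first by move: v1; rewrite v0 size_m0.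
  exists p; have sub : ([mset p] `<=` pos w v)%mset by rewrite msub1set.
  rewrite -{1}(msubK sub) (_ : (_ `\` _)%mset = 0) ?addr0 //.
  by apply: size_meq0; move: v1; rewrite -{1}(msubK sub) size_madd enum_msetn => -[].
move: le; rewrite big_cons posD pv => /msubsetP le.
have [pA|pA] := boolP (p \in A).
  have [|Y [R [yYR eY]]] := IHy (A `\` [mset p])%mset y1'.
    by apply/msubsetP => q; have := le q; rewrite maddE msetE2; mlia.
  exists (v :: Y), R; split; first by rewrite /= perm_cons.
  by rewrite big_cons posD pv eY msubK // msub1set.
have [|Y [R [yYR eY]]] := IHy A y1'.
  apply/msubsetP => q; have := le q; rewrite maddE msetnE; case: eqP => [->|_ //].
  by rewrite (mset_eq0P pA).
exists Y, (v :: R); split=> //.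
by rewrite -(perm_cons v) in yYR; rewrite (perm_trans yYR) // -cat1s perm_catCA.
Qed.

(** Groups are picked for the elements of [s] in turn; at the end nothing of [y] remains, because
    each of its elements would contribute a nonnegative prime. *)
Lemma group_targets s y : (forall v, v \in y -> size (pos w v) = 1%N) ->
  pos w (\sum_(u <- s) u) = pos w (\sum_(v <- y) v) ->
  exists Y : nat -> seq {mset P}, perm_eq (flatten (mkseq Y (size s))) y /\
    forall j, (j < size s)%N -> pos w (nth 0 s j) = pos w (\sum_(v <- Y j) v).
Proof.
elim: s y => [|u s IHs] y y1 e.
  exists (fun=> [::]); split=> //; case: y y1 e => // v y y1.
  rewrite big_nil big_cons pos0 posD => /esym /madd_eq0[v0 _].
  by have := y1 v (mem_head _ _); rewrite v0 size_m0.
have [|Y0 [R [yYR eY]]] := @pick_group (pos w u) y y1.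
  by rewrite -e big_cons posD msub_add.
have [v vR||Y [pY eYs]] := IHs R.
- by apply: y1; rewrite (perm_mem yYR) mem_cat vR orbT.
- apply: (@addmI _ (pos w u)); rewrite -[in RHS]eY -!posD -big_cat /=.
  by rewrite -(perm_big _ yYR) -e big_cons.
exists (fun j => if j is i.+1 then Y i else Y0); split.
  rewrite perm_sym (perm_trans yYR) // /mkseq /= perm_cat2l perm_sym.
  by rewrite -[1%N]addn0 iotaDl -map_comp.
by case=> [_|j jk] //=; apply: eYs.
Qed.

(** Double induction: outer on the length still to be gained, inner on the number of missing target
    classes. A step that lengthens the factorization restarts with a new grouping; one that does not
    keeps the grouping and lowers the inner measure. When no class is missing, swaps finish. *)
Lemma good_chain (M N : nat) s y :
  davenport_bound (diag_pairs G0) N ->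
  (forall p, p \in (\sum_(v <- y) v : {mset P}) -> w p < 0 -> - M%:Z <= w p) ->
  (forall v, v \in y -> good w v) ->
  {in s, forall u, zatom w u} -> \sum_(u <- s) u = \sum_(v <- y) v ->
  fact_chain (maxn (M * N) 2) s y.
Proof.
move=> dav yM gy; set x := \sum_(v <- y) v in yM *.
have y1 v : v \in y -> size (pos w v) = 1%N by move=> /gy[].
(* Every atom has at least one nonnegative prime and those of [y] have exactly one, so [y] has
   maximal length. *)
have sizey t : {in t, forall u, zatom w u} -> \sum_(u <- t) u = x ->
    (size t <= size y)%N.
  move=> At et; have : size (pos w (\sum_(u <- t) u)) = size (pos w x) by rewrite et.
  rewrite /x !(big_morph (pos w) (@posD _ w) (pos0 w)) !size_msum.
  have -> : (\sum_(v <- y) size (pos w v) = size y)%N.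
    by rewrite -sum1_size big_seq [RHS]big_seq; apply: eq_bigr => v /y1.
  move=> <-.
  by rewrite -sum1_size big_seq [leqRHS]big_seq; apply: leq_sum => u /At/zatom_pos.
have [n] := ubnP (size y - size s); elim: n s => // n IHn s; rewrite ltnS => len As es.
have [|Y [pY posY]] := @group_targets s y y1; first by rewrite es.
pose k := size s; pose v j : {mset P} := \sum_(b <- Y j) b.
have gY j b : (j < k)%N -> b \in Y j -> good w b.
  move=> jk bY; apply: gy; rewrite -(perm_mem pY); apply/flattenP.
  by exists (Y j) => //; apply/mapP; exists j; rewrite // mem_iota.
have zv j : (j < k)%N -> zerosum w (v j).
  move=> jk; rewrite /zerosum /v (big_morph (wsum w) (@wsumD _ w) (wsum0 w)).
  by rewrite big_seq big1 // => b /(gY j b jk)[].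
have sv : \sum_(j < k) v j = x by rewrite -big_flatten_mkseq (perm_big _ pY).
rewrite -[s](mkseq_nth 0) -/k.
have Au j : (j < k)%N -> zatom w (nth 0 s j) by move=> jk; apply/As/mem_nth.
have su : \sum_(j < k) nth 0 s j = x by rewrite -es (big_nth 0) big_mkord.
(* The atoms become a variable while the targets [v] stay fixed, since the inner induction changes
   only the atoms. *)
move: (nth 0 s) Au posY su => u.
have [m] := ubnP (\sum_(j < k) size (cl (v j) `\` cl (u j))%mset)%N.
elim: m u => // m IHm u; rewrite ltnS => lem Au posY su.
have [[j jk ne]|same] := pselect (exists2 j, (j < k)%N & cl (u j) <> cl (v j)).
  have [|W [W0 posW step dec]] := class_step dav yM Au zv posY su sv.
    by exists j.
  have [_ [_ [_ [_ _ _ kt [At et]]]]] := step.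
  apply: (fact_chain_step step); rewrite big_mkseq su in et.
  rewrite size_mkseq leq_eqVlt in kt; case/orP: kt => [/eqP kt|kt]; last first.
    apply: IHn => //; have := sizey _ At (esym et); move: len kt; rewrite -/k; lia.
  (* These [k] nonempty sequences have total length [k], so each is a singleton. *)
  have W1 i : (i < k)%N -> W i = [:: head 0 (W i)].
    move=> ik; have := kt; rewrite size_flatten /shape -map_comp sumn_map.
    rewrite -{1}(size_iota 0 k) -sum1_size.
    have Ik i' : i' \in iota 0 k -> (1 <= size (W i'))%N.
      by rewrite mem_iota => /W0; case: (W i').
    have ii : i \in iota 0 k by rewrite mem_iota.
    rewrite (big_rem i) // [RHS](big_rem i) //=.
    have le : (\sum_(i' <- rem i (iota 0 k)) 1
               <= \sum_(i' <- rem i (iota 0 k)) size (W i'))%N.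
      by rewrite big_seq [leqRHS]big_seq; apply: leq_sum => i' /mem_rem /Ik.
    by move: (Ik i ii) le; case: (W i) => [|b [|b' r]] //=; lia.
  have eW : flatten (mkseq W k) = mkseq (fun i => head 0 (W i)) k.
    rewrite /mkseq (_ : map W _ = map (fun i => [:: head 0 (W i)]) (iota 0 k)).
      by elim: (iota 0 k) => //= i r ->.
    by apply/eq_in_map => i; rewrite mem_iota => /W1.
  have eW' i : (i < k)%N -> head 0 (W i) = \sum_(a <- W i) a.
    by move=> ik; rewrite [in RHS]W1 // big_seq1.
  rewrite eW; apply: IHm.
  - apply: leq_trans lem; apply: leq_ltn_trans dec; apply: leq_sum => i _.
    by rewrite eW' ?ltn_ord.
  - move=> i ik; apply: At; rewrite eW; apply/mapP.
    by exists i; rewrite // mem_iota.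
  - by move=> i ik; rewrite -posY // -posW // eW'.
  - by move: et; rewrite eW big_mkseq => /esym.
have cuv j : (j < k)%N -> cl (u j) = cl (v j).
  by move=> jk; apply: contrapT => ne; apply: same; exists j.
(* The classes of the first atom in the group lift to a nonempty zero-sum part of the atom [u j],
   which must be all of it; nothing is left for a second atom. *)
have Y1 j : (j < k)%N -> Y j = [:: v j].
  move=> jk; have := cuv j jk; have := posY j jk; rewrite /v.
  have := gY j; case: (Y j) => [|b r] gb; rewrite ?big_nil ?big_cons.
    rewrite pos0 => p0; have := zatom_pos (Au j jk).
    by rewrite p0 size_m0.
  have nz b' : b' \in b :: r -> b' <> 0.
    by move=> /(gb _ jk)[_ b1] b0; move: b1; rewrite b0 pos0 size_m0.
  move=> _ cub; have [zu u0 irr] := Au j jk.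
  have [|X Xu eX] := @mmap_lift _ _ w (u j) (cl b).
    by rewrite -/cl cub /cl mmapD msub_add.
  have [zb _] := gb _ jk (mem_head _ _).
  have zX : zerosum w X by rewrite /zerosum -seq_sum_cl eX seq_sum_cl.
  have eu := msubK Xu.
  have zr : zerosum w (u j `\` X)%mset.
    by move: zu; rewrite -{1}eu /zerosum wsumD zX add0r.
  have [X0|r0] := irr _ _ zX zr (esym eu).
    by case: (nz b (mem_head _ _)); apply: (@mmap_eq0 _ _ w); rewrite -/cl -eX X0 mmap0.
  move: cub; rewrite -eu r0 addr0 /cl eX mmapD -[LHS]addr0 => /addmI /esym /mmap_eq0.
  case: r nz {gb} => [|b' r] nz; first by rewrite big_nil addr0.
  rewrite big_cons => /madd_eq0[b'0 _]; case: (nz b') => //.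
  by rewrite !inE eqxx orbT.
apply: (fact_chain_permr (t := mkseq v k)).
  apply: swap_chain => //; first by rewrite leq_max orbT.
    by move=> j jk; apply: (gY j) => //; rewrite Y1 // mem_head.
  by rewrite su.
rewrite (_ : mkseq v k = flatten (mkseq Y k)) //.
rewrite /mkseq (_ : map Y _ = map (fun j => [:: v j]) (iota 0 k)).
  by elim: (iota 0 k) => //= j r ->.
by apply/eq_in_map => j; rewrite mem_iota => /Y1.
Qed.

End Chains.

(** * Transfer to the Krull monoid *)

Lemma count_ge0 (s : seq int) :
  count (fun g => 0 <= g) s = (count (fun g => (0 < g)%R) s + count_mem 0%R s)%N.
Proof.
elim: s => //= g s ->; rewrite addnACA; congr (_ + _)%N.
by rewrite le_eqVlt eq_sym; case: eqVneq => [->|] //=; rewrite ?ltxx ?addn0.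
Qed.

(** Each atom contributes at least one nonnegative prime, so equality of the totals forces exactly
    one. *)
Lemma zatoms_good (P : choiceType) (w : P -> int) (s : seq {mset P}) :
  {in s, forall u, zatom w u} ->
  size (pos w (\sum_(u <- s) u)) = size s -> forall u, u \in s -> good w u.
Proof.
move=> As; rewrite (big_morph (pos w) (@posD _ w) (pos0 w)) size_msum.
rewrite -sum1_size => e u us; split; first by case: (As u us).
have As' v : v \in s -> (1 <= size (pos w v))%N by move/As/zatom_pos.
move: e; rewrite (big_rem u us) [RHS](big_rem u us) /=.
have : (\sum_(v <- rem u s) 1 <= \sum_(v <- rem u s) size (pos w v))%N.
  by rewrite big_seq [leqRHS]big_seq; apply: leq_sum => v /mem_rem /As'.
move: (As' u us).
by move: (size _) (\sum_(v <- _) 1)%N (\sum_(v <- _) size _)%N => a b c; lia.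
Qed.

(** The sum [L] of the absolute values of the negative elements gives a lower bound; shifting by [L]
    reduces to a minimum of natural numbers. *)
Lemma intset_minP (A : set int) (m : int) : finite_set (negative A) -> A m ->
  A (intset_min A) /\ lbound A (intset_min A).
Proof.
move=> /finite_seqP[d ed] Am; apply: (@xgetPex _ 0 [set m | A m /\ lbound A m]).
pose L : nat := (\sum_(g <- d) absz g)%N.
have AL g : A g -> - L%:Z <= g.
  move=> Ag; have [g0|g0] := leP 0 g; first by apply: le_trans g0; rewrite oppr_le0.
  have gd : g \in d by have : negative A g by []; rewrite ed.
  by have : (absz g <= L)%N; [rewrite /L (big_rem g gd) leq_addr|lia].
have ex : exists n : nat, `[< A (n%:Z - L%:Z) >].
  exists (absz (m + L%:Z)); apply/asboolP; have := AL m Am.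
  by rewrite -subr_ge0 opprK => h; rewrite gez0_abs // addrK.
case: (ex_minnP ex) => n /asboolP An nmin; exists (n%:Z - L%:Z); split=> // g Ag.
have gL := AL g Ag; have h : 0 <= g + L%:Z by lia.
have := nmin (absz (g + L%:Z)); rewrite gez0_abs // addrK.
by move=> /(_ (asboolT Ag)); lia.
Qed.

Section Transfer.
Variables (H : cmonoidType) (P : choiceType).
Variables (phi : {additive H -> {mset P}}).
Variables (iota : {additive class_group phi -> int}).
Hypothesis phi_div : divisor_hom phi.
Hypothesis iota_inj : injective iota.

Let w := prime_class iota.

Lemma wsum_class x : wsum w x = iota (class_of phi x).
Proof.
rewrite /wsum -{2}[x]seq_mset_id -sum_mset1.
elim: (enum_mset x) => [|p s IHs]; last by rewrite !big_cons class_ofD raddfD IHs.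
by rewrite !big_nil -(raddf0 phi) class_of_phi raddf0.
Qed.

Lemma phi_munit u : munit u -> phi u = 0.
Proof.
by move=> [b ub]; have := raddf0 phi; rewrite -ub raddfD => /madd_eq0[].
Qed.

Definition red_phi (x : reduced H) : {mset P} := phi (repr x).

Lemma red_phi_pi a : red_phi (\pi_(reduced H) a) = phi a.
Proof.
rewrite /red_phi; set b := repr _.
have /eqmodP/asboolP[u /phi_munit u0 ->] : a = b %[mod reduced H] by rewrite reprK.
by rewrite raddfD u0 addr0.
Qed.

(** Reduces everything to zero-sum multisets of primes. For injectivity, equal images give
    divisibility with a cofactor killed by [phi]; such a cofactor divides 0, so it is a unit. *)
Lemma red_phi_embeds : embeds_onto (zerosum w) red_phi.
Proof.
have phiD : {morph red_phi : x y / x + y}.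
  by move=> x y; rewrite -[x]reprK -[y]reprK -pi_red_addE !red_phi_pi raddfD.
split=> //.
- by apply: (@addmI _ (red_phi 0)); rewrite -phiD !addr0.
- move=> x y; rewrite -[x]reprK -[y]reprK !red_phi_pi => e.
  have [c ec] : mdvd (repr x) (repr y) by apply: phi_div; exists 0; rewrite addr0.
  apply/eqmodP/asboolP; exists c => //.
  have c0 : phi c = 0.
    by move: e; rewrite ec raddfD -{1}[phi (repr x)]addr0 => /addmI ->.
  have [d cd] : mdvd c 0 by apply: phi_div; exists 0; rewrite c0 raddf0 addr0.
  by exists d.
- by move=> x; rewrite /zerosum wsum_class class_of_phi raddf0.
(* Surjectivity: a zero class makes [x] a difference of [phi a] and [phi b], so [phi b] divides
   [phi a], hence [b] divides [a], and the cofactor maps to [x]. *)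
move=> x; rewrite /zerosum wsum_class -(raddf0 iota) => /iota_inj.
rewrite -(raddf0 (\pi_(Quotient.quot (qimage phi)))) => /eqmodP.
rewrite /= /Quotient.equiv subr0 => /asboolP[a [b exab]].
have /eqmodP/eqP : qincl (x + phi b) = qincl (phi a) by rewrite qincl_additive exab subrK.
rewrite /= !addr0 => e.
have [c ec] : mdvd b a by apply: phi_div; exists x; rewrite -e addrC.
exists (\pi_(reduced H) c); rewrite red_phi_pi; apply: (@addmI _ (phi b)).
by rewrite -raddfD -ec -e addrC.
Qed.

Definition fact_values (z : Zmon H) : {mset {mset P}} := atom_values red_phi z.

Lemma fact_values_inj : injective fact_values.
Proof.
have [_ _ finj _ _] := red_phi_embeds.
by apply: mmap_inj; apply: inj_comp finj val_inj.
Qed.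

Lemma factorizationsP a z :
  factorizations a z <-> \sum_(u <- fact_values z) u = phi a.
Proof.
have [_ _ finj _ _] := red_phi_embeds.
rewrite -(embeds_fprod red_phi_embeds) -red_phi_pi; split=> [-> //|/finj //].
Qed.

Lemma fact_valuesP (s : seq {mset P}) : {in s, forall u, zatom w u} ->
  exists z, fact_values z = seq_mset s.
Proof.
move=> As; apply: (atom_valuesP red_phi_embeds (@madd_eq0 _)) => u.
by rewrite (perm_mem (perm_eq_seq_mset s)); exact: As.
Qed.

Lemma fact_values_zatom z : {in fact_values z, forall u, zatom w u}.
Proof. by move=> u; apply: (atom_values_relatom red_phi_embeds (@madd_eq0 _)). Qed.

(** The gcd contains [c], so cancelling it leaves at most [s] and [t]. *)
Lemma fdist_add (c s t : Zmon H) (B : nat) :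
  (size s <= B)%N -> (size t <= B)%N -> (fdist (c + s)%R (c + t)%R <= B)%N.
Proof.
move=> sB tB; rewrite geq_max; apply/andP; split;
  [apply: leq_trans sB|apply: leq_trans tB]; apply: size_msub; apply/msubsetP => u;
  rewrite !(maddE, msetE2); mlia.
Qed.

Lemma fact_step_dist (B : nat) s t z z' :
  fact_values z = seq_mset s -> fact_values z' = seq_mset t ->
  fact_step w B s t -> (fdist z z' <= B)%N.
Proof.
move=> ez ez' [c [s1 [t1 [ps pt [s1B t1B] _ [At _]]]]].
have As u : u \in s -> zatom w u.
  by move=> us; apply: (@fact_values_zatom z); rewrite ez (perm_mem (perm_eq_seq_mset s)).
have [|zc ec] := @fact_valuesP c.
  by move=> u uc; apply: At; rewrite (perm_mem pt) mem_cat uc.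
have [|zs es] := @fact_valuesP s1.
  by move=> u uc; apply: As; rewrite (perm_mem ps) mem_cat uc orbT.
have [|zt et] := @fact_valuesP t1.
  by move=> u uc; apply: At; rewrite (perm_mem pt) mem_cat uc orbT.
have -> : z = zc + zs.
  apply: fact_values_inj; rewrite /fact_values /atom_values mmapD.
  rewrite -!/(atom_values _ _) -!/(fact_values _) ez ec es -seq_mset_cat.
  exact/eq_seq_msetP.
have -> : z' = zc + zt.
  apply: fact_values_inj; rewrite /fact_values /atom_values mmapD.
  rewrite -!/(atom_values _ _) -!/(fact_values _) ez' ec et -seq_mset_cat.
  exact/eq_seq_msetP.
have sizeE z1 s2 : fact_values z1 = seq_mset s2 -> size z1 = size s2.
  by move=> e; rewrite -(size_seq_mset s2) -e size_mmap.
by apply: fdist_add; [rewrite (sizeE _ _ es)|rewrite (sizeE _ _ et)].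
Qed.

Lemma fact_chain_transfer (B : nat) a s t z y :
  fact_chain w B s t -> fact_values z = seq_mset s -> fact_values y = seq_mset t ->
  factorizations a z ->
  exists (r : nat) (c : nat -> Zmon H),
    [/\ c 0%N = z, c r = y,
        forall i, (i <= r)%N -> factorizations a (c i),
        forall i, (i < r)%N -> (size (c i) <= size (c i.+1))%N &
        forall i, (i < r)%N -> (fdist (c i) (c i.+1) <= B)%N].
Proof.
move=> st; elim: st z y => {s t} [s t /eq_seq_msetP st|s t t' st _ IH] z y.
  move=> ez ey az; exists 0%N, (fun=> z); split=> //.
  by apply: fact_values_inj; rewrite ez ey.
move=> ez ey az; have [_ [_ [_ [_ _ _ le [At est]]]]] := st.
have [z' ez'] := fact_valuesP At.
have az' : factorizations a z'.
  apply/factorizationsP; move/factorizationsP: az.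
  by rewrite ez ez' !big_seq_mset est.
have [r [c [c0 cr ca cs cd]]] := IH z' y ez' ey az'.
exists r.+1, (fun i => if i is j.+1 then c j else z); split=> //.
- by case=> [//|i]; exact: ca.
- case=> [_|i]; last exact: cs.
  by rewrite c0 -(size_mmap (red_phi \o val) z) -(size_mmap (red_phi \o val) z')
    -!/(atom_values _ _) -!/(fact_values _) ez ez' !size_seq_mset.
- by case=> [_|i]; [rewrite c0; exact: fact_step_dist ez ez' st|exact: cd].
Qed.

(** The assumed maximal length is also the number of nonnegative primes in [phi a], so [y] has as
    many atoms as there are such primes. *)
Lemma max_length_good a (y : Zmon H) : factorizations a y ->
  is_max (lengths a) (size y) ->
  is_max (lengths a) (size (pos_part (beta iota a)) + beta iota a 0)%N ->
  forall u, u \in fact_values y -> good w u.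
Proof.
move=> /factorizationsP ay [ly uy] [lm um]; apply: zatoms_good.
  exact: fact_values_zatom.
rewrite ay size_mmap size_posE count_ge0 -/(beta iota a).
have -> : size y = (size (pos_part (beta iota a)) + beta iota a 0)%N.
  by apply/eqP; rewrite eq_le um // uy.
by rewrite size_seq_mset size_filter count_mem_mset.
Qed.

End Transfer.

(** * Conclusion for Krull monoids with infinite cyclic class group *)

Theorem corollary7p4 (H : cmonoidType) (P : choiceType)
    (phi : {additive H -> {mset P}}) (iota : {additive class_group phi -> int}) :
  krull H ->
  divisor_hom phi ->
  cofinal_hom phi ->
  bijective iota ->
  finite_set (negative (GP iota)) ->
  forall a : H,
  is_max (lengths a) (size (pos_part (beta iota a)) + beta iota a 0)%N ->
  let M : int := `|intset_min (seq_supp (beta iota a))| in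
  let Dav : \bar int := rel_davenport (diag_pairs (negative (GP iota))) in
  [/\ forall z y : Zmon H,
        factorizations a z -> factorizations a y ->
        is_max (lengths a) (size y) ->
        exists (r : nat) (c : nat -> Zmon H),
          [/\ c 0%N = z, c r = y,
              forall i, (i <= r)%N -> factorizations a (c i),
              forall i, (i < r)%N -> (size (c i) <= size (c i.+1))%N &
              forall i, (i < r)%N ->
                ((fdist (c i) (c i.+1))%:Z%:E <= maxe (M%:E * Dav) 2%:E)%E],
      (maxe (M%:E * Dav) 2%:E
         <= maxe (`|intset_min (GP iota)|%:E * Dav) 2%:E)%E &
      (maxe (`|intset_min (GP iota)|%:E * Dav) 2%:E < +oo)%E].
Proof.
move=> _ phi_div _ /bij_inj iota_inj finG a maxa M Dav.
have [N dav eDav] : exists2 N : nat,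
    davenport_bound (diag_pairs (negative (GP iota))) N & Dav = N%:Z%:E%E.
  exact: rel_davenportP finG.
(* As the Davenport constant is the number [N], all bounds are integers, which also gives
   finiteness. *)
have bndE (K : int) : (maxe (K%:E * Dav) 2%:E)%E = (Num.max (K * N%:Z) 2)%:E%E.
  by rewrite eDav -EFinM -EFin_max.
have [suppGP sum0] := beta_block iota a.
have fin_supp : finite_set (negative (seq_supp (beta iota a))).
  by apply: sub_finite_set finG => g [/suppGP Gg g0]; split.
have MK : M <= `|intset_min (GP iota)|.
  have [[g Sg]|S0] := pselect (exists g, seq_supp (beta iota a) g); last first.
    (* For an empty block the default value of [intset_min] yields [M = 0]. *)
    rewrite /M (_ : intset_min _ = 0) ?normr0 //.
    by apply: xgetPN => g [Sg _]; apply: S0; exists g.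
  have [Sm lbm] := intset_minP fin_supp Sg.
  have [_ lbG] := intset_minP finG (suppGP _ Sg).
  (* A zero-sum sequence cannot have a positive minimum, and the minimum over all classes is no
     larger, so the absolute values compare. *)
  have m0 : intset_min (seq_supp (beta iota a)) <= 0.
    rewrite leNgt; apply/negP => mpos; move: sum0; apply/eqP.
    rewrite gt_eqF // /seq_sum (big_rem _ Sm) /=; apply: ltr_wpDr => //.
    rewrite big_seq; apply: sumr_ge0 => h /mem_rem Sh.
    exact: le_trans (ltW mpos) (lbm _ Sh).
  have := lbG _ (suppGP _ Sm); move: m0; rewrite /M.
  by move: (intset_min _) (intset_min _) => m n; lia.
(* A negative class in the support makes the minimum negative, so [M] is minus that minimum. *)
have negM p : p \in phi a -> prime_class iota p < 0 ->
    - (absz M)%:Z <= prime_class iota p.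
  move=> pa wp; have Sg : seq_supp (beta iota a) (prime_class iota p).
    exact: mmap_f.
  have [_ /(_ _ Sg)] := intset_minP fin_supp Sg.
  by move: wp; rewrite /M; move: (intset_min _) (prime_class _ _) => m n; lia.
split=> [z y az ay maxy| |]; rewrite ?bndE ?ltry //.
- have gy := max_length_good phi_div iota_inj ay maxy maxa.
  have sy := (factorizationsP phi_div iota_inj a y).1 ay.
  have sz := (factorizationsP phi_div iota_inj a z).1 az.
  have chain : fact_chain (prime_class iota) (maxn (absz M * N) 2)
      (fact_values phi z) (fact_values phi y).
    apply: good_chain => //.
    + by move=> p; rewrite sy; exact: negM.
    + exact: fact_values_zatom.
    + by rewrite sy.
  have [|||r [c [c0 cr ca cs cd]]] :=
    fact_chain_transfer phi_div iota_inj (a := a) (z := z) (y := y) chain.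
  + by rewrite seq_mset_id.
  + by rewrite seq_mset_id.
  + exact: az.
  exists r, c; split=> // i ir; rewrite lee_fin.
  apply: le_trans (_ : (maxn (absz M * N) 2)%:Z <= _); first exact: cd.
  by rewrite /M; lia.
- rewrite lee_fin; have : M * N%:Z <= `|intset_min (GP iota)| * N%:Z.
    exact: ler_wpM2r.
  by lia.
Qed.
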